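(* The subgroup $\mathcal{M}_n:=\{\omega_u\mid u\in\mathbb{M}_n^*\}$ of $G_n$ equals $\{\sigma\in G_n\mid \sigma(x_i)-x_i\in\mathbb{F}_n,\ \sigma(y_i)-y_i\in\mathbb{F}_n\ \text{for all } i=1,\dots,n\}$. Moreover, fixing for each $s=1,\dots,n$ an arbitrary order on the subsets $I\subseteq\{1,\dots,n\}$ with $|I|=s$, every $\sigma\in\mathcal{M}_n$ can be written uniquely as $$\sigma=\prod_{|I_1|=1}\omega_{u(I_1)}\cdot\prod_{|I_2|=2}\omega_{u(I_2)}\cdots\prod_{|I_n|=n}\omega_{u(I_n)}$$ with $u(I_s)\in\mathbb{M}_{I_s}^*$.
   Context: $K$ is a field of characteristic zero. $\mathbb{S}_n$ is the $K$-algebra generated by $x_1,\dots,x_n,y_1,\dots,y_n$ with defining relations $y_ix_i=1$ and $[x_i,y_j]=[x_i,x_j]=[y_i,y_j]=0$ for $i\ne j$; $G_n=\mathrm{Aut}_{K\text{-alg}}(\mathbb{S}_n)$, and $\omega_u(a)=uau^{-1}$. For $k,l\in\mathbb{N}$, $E_{kl}(i):=x_i^ky_i^l-x_i^{k+1}y_i^{l+1}$. For a nonempty $I\subseteq\{1,\dots,n\}$, $F(I):=\bigoplus_{\alpha,\beta\in\mathbb{N}^I}K\prod_{i\in I}E_{\alpha_i\beta_i}(i)$ (an algebra without $1$ isomorphic to $M_\infty(K)$), $\mathbb{M}_I:=1+F(I)$ with group of units $\mathbb{M}_I^*$. $\mathbb{F}_n:=K\oplus\bigoplus_{\emptyset\ne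 I\subseteq\{1,\dots,n\}}F(I)$ (a subalgebra of $\mathbb{S}_n$), $\mathbb{M}_n:=1+\sum_{\emptyset\ne I}F(I)$ (a multiplicative monoid), and $\mathbb{M}_n^*$ its group of units. *)

(* Defs.v *)
From HB Require Import structures.
From mathcomp Require Import all_boot all_order all_algebra.
Set Implicit Arguments. Unset Strict Implicit. Unset Printing Implicit Defensive.
Import Order.TTheory GRing.Theory.
Local Open Scope ring_scope.

Section Defs.
Variable K : fieldType.

Definition alg_morph (A B : algType K) (f : A -> B) : Prop :=
  [/\ (forall (k : K) (a b : A), f (k *: a + b) = k *: f a + f b),
      f 1 = 1 &
      (forall a b : A, f (a * b) = f a * f b)].

Definition Sn_relations (n : nat) (B : algType K) (x y : 'I_n -> B) : Prop :=
  (forall i, y i * x i = 1) /\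
  (forall i j : 'I_n, i != j ->
     [/\ x i * y j = y j * x i, x i * x j = x j * x i & y i * y j = y j * y i]).

(* (A, x, y) is the K-algebra presented by generators x_i, y_i and the
   relations above: universal property (existence and uniqueness of the
   induced algebra morphism into every K-algebra). *)
Definition is_Sn (n : nat) (A : algType K) (x y : 'I_n -> A) : Prop :=
  Sn_relations x y /\
  forall (B : algType K) (xb yb : 'I_n -> B), Sn_relations xb yb ->
    (exists f : A -> B, alg_morph f /\ forall i, f (x i) = xb i /\ f (y i) = yb i) /\
    (forall f g : A -> B, alg_morph f -> alg_morph g ->
        (forall i, f (x i) = g (x i) /\ f (y i) = g (y i)) -> f =1 g).

Definition is_alg_aut (A : algType K) (s : A -> A) : Prop :=
  alg_morph s /\ bijective s.

Variables (n : nat) (A : unitAlgType K) (x y : 'I_n -> A).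

Definition Eu (k l : nat) (i : 'I_n) : A :=
  x i ^+ k * y i ^+ l - x i ^+ k.+1 * y i ^+ l.+1.

Definition Eprod (I : {set 'I_n}) (al be : 'I_n -> nat) : A :=
  \prod_(i < n | i \in I) Eu (al i) (be i) i.

Definition inF (I : {set 'I_n}) (a : A) : Prop :=
  exists s : seq (K * (('I_n -> nat) * ('I_n -> nat))),
    a = \sum_(t <- s) t.1 *: Eprod I t.2.1 t.2.2.

Definition inFn (a : A) : Prop :=
  exists (c : K) (f : {set 'I_n} -> A),
    (forall I, I != set0 -> inF I (f I)) /\
    a = c%:A + \sum_(I : {set 'I_n} | I != set0) f I.

Definition inMn (a : A) : Prop :=
  exists f : {set 'I_n} -> A,
    (forall I, I != set0 -> inF I (f I)) /\
    a = 1 + \sum_(I : {set 'I_n} | I != set0) f I.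

Definition inMI (I : {set 'I_n}) (a : A) : Prop :=
  exists f, inF I f /\ a = 1 + f.

Definition unitMn (u : A) : Prop := [/\ u \is a GRing.unit, inMn u & inMn u^-1].
Definition unitMI (I : {set 'I_n}) (u : A) : Prop :=
  [/\ u \is a GRing.unit, inMI I u & inMI I u^-1].

Definition omega (u : A) : A -> A := fun a => u * a * u^-1.

Definition omega_prod (ord : seq {set 'I_n}) (u : {set 'I_n} -> A) : A -> A :=
  foldr (fun I f => fun a => omega (u I) (f a)) id ord.

End Defs.

(* Main.v *)
(* Write e_i = 1 - x_i y_i, let P_i be the ideal of elements killed on the right
   by a power of x_i, and call S_I the subalgebra generated by x_i, y_i, i in I;
   then F(I) consists of the elements of S_I lying in P_i for every i in I.

   Let sigma be an automorphism with sigma(x_i) - x_i and sigma(y_i) - y_i in F_n.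
   The relation sigma(y_i) sigma(x_i) = 1, read modulo P_i where x_i becomes
   central and invertible, puts both differences in P_i, so sigma(P_i) is
   contained in P_i.  As P_i is prime and every nonzero ideal contains the
   product of all e_j, sigma(P_i) contains some P_j, hence equals P_i: elements of
   P_i are also killed by high powers of sigma(x_i).

   Take I minimal among the sets carrying a component of the differences, and let
   x'_i, y'_i be x_i, y_i plus this component.  They satisfy the relations of
   S_I, and for N large u = y'_i^N x_i^N lies in 1 + F(I) and conjugates x_k, y_k
   into x'_k, y'_k for every k <> i.  When |I| >= 2 this u does not depend on
   i in I, so it handles every k in I.  When |I| = 1 one needs instead that
   1 + M_oo(K) is Dedekind finite, which excludes an index shift.  Replacing sigma
   by omega_u^-1 sigma removes the component in I and only alters components in
   larger sets, so that sigma is peeled off to the identity along any ordering by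
   cardinality.  The same triangular structure gives uniqueness. *)
Require Import Defs.
From HB Require Import structures.
From mathcomp Require Import all_boot all_order all_algebra.
From mathcomp Require Import boolp zify.
Set Implicit Arguments. Unset Strict Implicit. Unset Printing Implicit Defensive.
Import GRing.Theory.
Local Open Scope ring_scope.

(** * Linear endomorphisms of the space of sequences *)

Section SequenceEndomorphisms.
Variables (K : fieldType) (V : lmodType K).

Definition seq_linear (f : (nat -> V) -> nat -> V) : Prop :=
  forall k s t, f (fun j => k *: s j + t j) = (fun j => k *: f s j + f t j).

(** Target algebra of the representation built in [gen_inj]. Linearity is what makes composition
    right distributive and compatible with scalars. *)
Definition seq_end := {f : (nat -> V) -> nat -> V | `[< seq_linear f >]}.
HB.instance Definition _ := gen_eqMixin seq_end.
HB.instance Definition _ := gen_choiceMixin seq_end.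

Definition seq_end_fun (f : seq_end) : (nat -> V) -> nat -> V := sval f.
Coercion seq_end_fun : seq_end >-> Funclass.

Lemma seq_end_linear (f : seq_end) : seq_linear f.
Proof. by case: f => f fl; apply/asboolP. Qed.

Lemma seq_end_ext (f g : seq_end) : (forall s j, f s j = g s j) -> f = g.
Proof.
case: f g => f fl [g gl] /= fg; apply: eq_exist.
by apply/funext => s; apply/funext => j; apply: fg.
Qed.

Definition mk_seq_end f (fl : seq_linear f) : seq_end := exist _ f (asboolT fl).

Lemma seq_endP f (fl : seq_linear f) (s : nat -> V) j : mk_seq_end fl s j = f s j.
Proof. by []. Qed.

Fact seq_end0_linear : seq_linear (fun _ _ => 0).
Proof. by move=> k s t; apply/funext => j; rewrite scaler0 addr0. Qed.
Fact seq_end1_linear : seq_linear id.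
Proof. by []. Qed.
Fact seq_endN_linear (f : seq_end) : seq_linear (fun s j => - f s j).
Proof.
by move=> k s t; apply/funext => j; rewrite seq_end_linear opprD scalerN.
Qed.
Fact seq_endD_linear (f g : seq_end) : seq_linear (fun s j => f s j + g s j).
Proof.
by move=> k s t; apply/funext => j; rewrite !seq_end_linear scalerDr addrACA.
Qed.
Fact seq_endM_linear (f g : seq_end) : seq_linear (fun s => f (g s)).
Proof. by move=> k s t; rewrite !seq_end_linear. Qed.
Fact seq_endZ_linear (c : K) (f : seq_end) : seq_linear (fun s j => c *: f s j).
Proof.
move=> k s t; apply/funext => j; rewrite seq_end_linear scalerDr !scalerA.
by rewrite [c * k]mulrC.
Qed.

Definition seq_end0 := mk_seq_end seq_end0_linear.
Definition seq_end1 := mk_seq_end seq_end1_linear.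
Definition seq_endN f := mk_seq_end (seq_endN_linear f).
Definition seq_endD f g := mk_seq_end (seq_endD_linear f g).
Definition seq_endM f g := mk_seq_end (seq_endM_linear f g).
Definition seq_endZ c f := mk_seq_end (seq_endZ_linear c f).

Fact seq_endDA : associative seq_endD.
Proof. by move=> f g h; apply: seq_end_ext => s j; rewrite !seq_endP addrA. Qed.
Fact seq_endDC : commutative seq_endD.
Proof. by move=> f g; apply: seq_end_ext => s j; rewrite !seq_endP addrC. Qed.
Fact seq_end0D : left_id seq_end0 seq_endD.
Proof. by move=> f; apply: seq_end_ext => s j; rewrite !seq_endP add0r. Qed.
Fact seq_endND : left_inverse seq_end0 seq_endN seq_endD.
Proof. by move=> f; apply: seq_end_ext => s j; rewrite !seq_endP addNr. Qed.
HB.instance Definition _ :=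
  GRing.isZmodule.Build seq_end seq_endDA seq_endDC seq_end0D seq_endND.

Fact seq_endMA : associative seq_endM.
Proof. by move=> f g h; apply: seq_end_ext. Qed.
Fact seq_end1M : left_id seq_end1 seq_endM.
Proof. by move=> f; apply: seq_end_ext. Qed.
Fact seq_endM1 : right_id seq_end1 seq_endM.
Proof. by move=> f; apply: seq_end_ext. Qed.
Fact seq_endMDl : left_distributive seq_endM seq_endD.
Proof. by move=> f g h; apply: seq_end_ext. Qed.
Fact seq_endMDr : right_distributive seq_endM seq_endD.
Proof.
move=> f g h; apply: seq_end_ext => s j; rewrite !seq_endP.
have -> : seq_endD g h s = (fun j => 1 *: g s j + h s j).
  by apply/funext => i; rewrite seq_endP scale1r.
by rewrite seq_end_linear scale1r.
Qed.
Hypothesis V_neq0 : exists v : V, v != 0.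
Fact seq_end1_neq0 : seq_end1 != 0 :> seq_end.
Proof.
case: V_neq0 => v; apply: contraNneq.
by move=> /(congr1 (fun f : seq_end => f (fun=> v) 0%N)) => /= ->.
Qed.
End SequenceEndomorphisms.

Section SequenceEndomorphismAlgebra.
Variables (K : fieldType) (A : algType K).
Fact alg_neq0 : exists v : A, v != 0.
Proof. by exists 1; apply: oner_neq0. Qed.
Notation E := (@seq_end K A).
HB.instance Definition _ := GRing.Zmodule_isNzRing.Build E
  (@seq_endMA K A) (@seq_end1M K A) (@seq_endM1 K A) (@seq_endMDl K A)
  (@seq_endMDr K A) (seq_end1_neq0 alg_neq0).

Fact seq_endZA (a b : K) (f : E) : seq_endZ a (seq_endZ b f) = seq_endZ (a * b) f.
Proof. by apply: seq_end_ext => s j; rewrite !seq_endP scalerA. Qed.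
Fact seq_end1Z : left_id 1 (@seq_endZ K A).
Proof. by move=> f; apply: seq_end_ext => s j; rewrite seq_endP scale1r. Qed.
Fact seq_endZDr : right_distributive (@seq_endZ K A) +%R.
Proof. by move=> a f g; apply: seq_end_ext => s j; rewrite !seq_endP scalerDr. Qed.
Fact seq_endZDl (f : E) : {morph (@seq_endZ K A)^~ f : a b / a + b}.
Proof. by move=> a b; apply: seq_end_ext => s j; rewrite !seq_endP scalerDl. Qed.
HB.instance Definition _ := GRing.Zmodule_isLmodule.Build K E
  seq_endZA seq_end1Z seq_endZDr seq_endZDl.
Fact seq_endZAl (a : K) (f g : E) : a *: (f * g) = (a *: f) * g.
Proof. by apply: seq_end_ext. Qed.
HB.instance Definition _ := GRing.Lmodule_isLalgebra.Build K E seq_endZAl.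
Fact seq_endZAr (a : K) (f g : E) : a *: (f * g) = f * (a *: g).
Proof.
apply: seq_end_ext => s j.
have f0 : f (fun=> 0) = (fun=> 0).
  have := seq_end_linear f (-1) (fun=> 0) (fun=> 0).
  have -> : (fun j : nat => -1 *: (0 : A) + 0) = (fun=> 0).
    by apply/funext => i; rewrite scaler0 addr0.
  by move=> ->; apply/funext => i; rewrite scaleN1r addNr.
have -> : seq_end_fun (f * (a *: g)) s j = f (fun i => a *: g s i + 0) j.
  by congr (f _ j); apply/funext => i; rewrite addr0.
by rewrite (seq_end_linear f a (g s) (fun=> 0)) f0 addr0.
Qed.
HB.instance Definition _ := GRing.Lalgebra_isAlgebra.Build K E seq_endZAr.
End SequenceEndomorphismAlgebra.

(** * The presented algebra *)

Section Words.
Variables (K : fieldType) (n : nat) (A : algType K) (x y : 'I_n -> A).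

(** The set [T] lists the excluded indices: [set0] allows all words and [setT] leaves only scalars.
    Words grow by one letter on the left, so inductions become letter-by-letter checks. *)
Inductive word_span (T : {set 'I_n}) : A -> Prop :=
| gen1 : word_span T 1
| gen_lin k a b : word_span T a -> word_span T b -> word_span T (k *: a + b)
| gen_xl i a : i \notin T -> word_span T a -> word_span T (x i * a)
| gen_yl i a : i \notin T -> word_span T a -> word_span T (y i * a).
Notation gen := word_span.

Implicit Types (T : {set 'I_n}) (i : 'I_n).

Lemma genD T a b : gen T a -> gen T b -> gen T (a + b).
Proof. by move=> ga gb; rewrite -[a]scale1r; apply: gen_lin. Qed.
Lemma gen0 T : gen T 0.
Proof. by rewrite -(addNr 1) -scaleN1r; apply: gen_lin; apply: gen1. Qed.
Lemma genZ T k a : gen T a -> gen T (k *: a).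
Proof. by move=> ga; rewrite -[_ *: _]addr0; apply: gen_lin => //; apply: gen0. Qed.
Lemma genN T a : gen T a -> gen T (- a).
Proof. by rewrite -scaleN1r; apply: genZ. Qed.
Lemma genB T a b : gen T a -> gen T b -> gen T (a - b).
Proof. by move=> ga /genN; apply: genD. Qed.
Lemma genM T a b : gen T a -> gen T b -> gen T (a * b).
Proof.
move=> ga gb; elim: ga => [|k c d _ gc _ gd|i c iT _ gc|i c iT _ gc].
- by rewrite mul1r.
- by rewrite mulrDl -scalerAl; apply: gen_lin.
- by rewrite -mulrA; apply: gen_xl.
- by rewrite -mulrA; apply: gen_yl.
Qed.
Lemma gen_x T i : i \notin T -> gen T (x i).
Proof. by move=> iT; rewrite -[x i]mulr1; apply: gen_xl => //; apply: gen1. Qed.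
Lemma gen_y T i : i \notin T -> gen T (y i).
Proof. by move=> iT; rewrite -[y i]mulr1; apply: gen_yl => //; apply: gen1. Qed.
Lemma genX T a k : gen T a -> gen T (a ^+ k).
Proof.
by move=> ga; elim: k => [|k gk]; rewrite ?expr0 ?exprS; [apply: gen1|apply: genM].
Qed.
Lemma genS (T U : {set 'I_n}) a : U \subset T -> gen T a -> gen U a.
Proof.
move=> UT; have nU i : i \notin T -> i \notin U by apply: contra; apply: (subsetP UT).
elim=> [|k b c _ gb _ gc|i b /nU iU _ gb|i b /nU iU _ gb].
- exact: gen1.
- exact: gen_lin.
- exact: gen_xl.
- exact: gen_yl.
Qed.
Lemma gen_setT a : gen setT a -> exists k : K, a = k%:A.
Proof.
elim=> [|k b c _ [kb ->] _ [kc ->]|i b|i b]; rewrite ?inE //.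
  by exists 1; rewrite scale1r.
by exists (k * kb + kc); rewrite scalerDl scalerA.
Qed.

(** * Consequences of the universal property *)

Section Presented.
Hypothesis hS : is_Sn x y.

Lemma yx i : y i * x i = 1.
Proof. by case: hS => -[h _] _; apply: h. Qed.
Lemma xyC i j : i != j -> x i * y j = y j * x i.
Proof. by case: hS => -[_ h] _ /h []. Qed.
Lemma xxC i j : x i * x j = x j * x i.
Proof. by case: (eqVneq i j) => [->//|]; case: hS => -[_ h] _ /h []. Qed.
Lemma yyC i j : y i * y j = y j * y i.
Proof. by case: (eqVneq i j) => [->//|]; case: hS => -[_ h] _ /h []. Qed.

Lemma gen_comm T i a : i \in T -> gen T a -> GRing.comm a (x i) /\ GRing.comm a (y i).
Proof.
move=> iT; elim=> [|k b c _ [bx by_] _ [cx cy]|j b jT _ [bx by_]|j b jT _ [bx by_]].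
- by split; apply/commr_sym/commr1.
- by split; apply/commr_sym; apply: commrD; apply/commr_sym => //;
    rewrite /GRing.comm -scalerAl -scalerAr ?bx ?by_.
- have ji : j != i by apply: contraNneq jT => ->.
  split; rewrite /GRing.comm; first by rewrite -mulrA bx !mulrA xxC.
  by rewrite -mulrA by_ !mulrA xyC.
- have ji : i != j by apply: contraNneq jT => <-.
  split; rewrite /GRing.comm; last by rewrite -mulrA by_ !mulrA yyC.
  by rewrite -mulrA bx !mulrA xyC.
Qed.
Lemma gen_commx T i a : i \in T -> gen T a -> GRing.comm a (x i).
Proof. by move=> iT /(gen_comm iT) []. Qed.
Lemma gen_commy T i a : i \in T -> gen T a -> GRing.comm a (y i).
Proof. by move=> iT /(gen_comm iT) []. Qed.

(* Freeness: let x_i, y_i shift A-valued sequences and let the other generators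
   multiply them termwise; then a word c in the other generators acts by c, and
   1 - x_i y_i keeps the term of index 0 only. *)
Lemma gen_inj T i c : i \in T -> gen T c -> (1 - x i * y i) * c = 0 -> c = 0.
Proof.
move=> iT gc.
have mul_lin (a : A) : seq_linear (fun (s : nat -> A) j => a * s j).
  by move=> k s t; apply/funext => j; rewrite mulrDr scalerAr.
have sx_lin : seq_linear (fun (s : nat -> A) j => if j is k.+1 then s k else 0).
  by move=> k s t; apply/funext => -[|j] //; rewrite scaler0 addr0.
have sy_lin : seq_linear (fun (s : nat -> A) j => s j.+1) by [].
pose xb k : seq_end A := if k == i then mk_seq_end sx_lin else mk_seq_end (mul_lin (x k)).
pose yb k : seq_end A := if k == i then mk_seq_end sy_lin else mk_seq_end (mul_lin (y k)).
have rel : Sn_relations xb yb.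
  split=> [k|k l kl]; rewrite /xb /yb.
    by case: (eqVneq k i) => _; apply: seq_end_ext => s j //=; rewrite mulrA yx mul1r.
  have [ki|ki] := eqVneq k i; have [li|li] := eqVneq l i.
  - by case/eqP: kl; rewrite ki li.
  - split; apply: seq_end_ext => s [|j] //=; rewrite ?mulr0 //.
  - split; apply: seq_end_ext => s [|j] //=; rewrite ?mulr0 //.
  - split; apply: seq_end_ext => s j /=; rewrite !mulrA ?[x k * _]xyC ?[x k * _]xxC //.
    by rewrite yyC.
case: hS => _ /(_ _ xb yb rel) [[f [[f_lin f1 fM] fxy]] _].
have gc' : gen [set i] c by apply: genS gc; rewrite sub1set.
have fc : f c = mk_seq_end (mul_lin c).
  elim: gc' => [|k b d _ gb _ gd|j b ji _ gb|j b ji _ gb].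
  - by rewrite f1; apply: seq_end_ext => s j /=; rewrite mul1r.
  - rewrite f_lin gb gd; apply: seq_end_ext => s j /=.
    by rewrite mulrDl scalerAl.
  - rewrite fM (proj1 (fxy j)) gb /xb; move: ji; rewrite inE => /negbTE ->.
    by apply: seq_end_ext => s m /=; rewrite mulrA.
  - rewrite fM (proj2 (fxy j)) gb /yb; move: ji; rewrite inE => /negbTE ->.
    by apply: seq_end_ext => s m /=; rewrite mulrA.
rewrite mulrBl mul1r => /eqP; rewrite subr_eq0 => /eqP cE.
(* Both sides are applied to the constant sequence 1 and read at index 0: c acts by multiplication
   and gives c, while x_i y_i c gives the 0 inserted by the shift. *)
have := congr1 (fun g : seq_end A => g (fun=> 1) 0%N) (congr1 f cE).
rewrite !fM fc (proj1 (fxy i)) /xb eqxx /= => <-.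
by rewrite mulr1.
Qed.

Definition in_gen : {pred A} := fun a => `[< gen set0 a >].
Fact in_gen_subalg : GRing.subalg_closed in_gen.
Proof.
split=> [|k b c|b c]; rewrite ?unfold_in.
- by apply/asboolT/gen1.
- by move=> /asboolP gb /asboolP gc; apply/asboolT; apply: gen_lin.
- by move=> /asboolP gb /asboolP gc; apply/asboolT; apply: genM.
Qed.
HB.instance Definition _ := GRing.isSubalgClosed.Build K A in_gen in_gen_subalg.

Record gen_alg := GenAlg { gen_val : A; _ : gen_val \in in_gen }.
HB.instance Definition _ := [isSub for gen_val].
HB.instance Definition _ := [Choice of gen_alg by <:].
HB.instance Definition _ := [SubChoice_isSubAlgebra of gen_alg by <:].

(** The map from A to the subalgebra of words, followed by the inclusion, fixes all generators and
    is therefore the identity by the uniqueness clause. *)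
Lemma gen_all a : gen set0 a.
Proof.
have in_x i : x i \in in_gen by apply/asboolT/gen_x; rewrite inE.
have in_y i : y i \in in_gen by apply/asboolT/gen_y; rewrite inE.
pose xb i : gen_alg := GenAlg (in_x i); pose yb i : gen_alg := GenAlg (in_y i).
have rel : Sn_relations xb yb.
  split=> [i|i j ij]; first by apply: val_inj; rewrite /= yx.
  by split; apply: val_inj; [apply: xyC | apply: xxC | apply: yyC].
case: hS => hR hU.
have [[f [f_mor fxy]] _] := hU _ _ _ rel.
have [_ /(_ (fun b => gen_val (f b)) id) fid] := hU _ _ _ hR.
have -> : a = gen_val (f a).
  rewrite fid //.
  - have [fl f1 fM] := f_mor.
    by split=> [k b c||b c]; rewrite ?fl ?f1 ?fM //.
  - by move=> i; have [-> ->] := fxy i.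
by case: (f a) => b /= /asboolP.
Qed.
End Presented.
End Words.

(** * Expansion in one variable *)

Section Corners.
Variables (K : fieldType) (n : nat) (A : algType K) (x y : 'I_n -> A).
Hypothesis hS : is_Sn x y.
Implicit Types (T : {set 'I_n}) (i j : 'I_n) (a b c : A) (p q : {poly A}).
Notation gen := (word_span x y).

(** The matrix unit E_00(i), an idempotent with e_i x_i = 0 and y_i e_i = 0. *)
Definition defect i : A := 1 - x i * y i.
Notation ei := defect.

Lemma ei_x i : ei i * x i = 0.
Proof. by rewrite mulrBl mul1r -mulrA (yx hS) mulr1 subrr. Qed.
Lemma y_ei i : y i * ei i = 0.
Proof. by rewrite mulrBr mulr1 mulrA (yx hS) mul1r subrr. Qed.
Lemma ei_idem i : ei i * ei i = ei i.
Proof. by rewrite {2}/ei mulrBr mulr1 mulrA ei_x mul0r subr0. Qed.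
Lemma gen_ei T i : i \notin T -> gen T (ei i).
Proof.
by move=> iT; apply: genB; [apply: gen1 | apply: genM; [apply: gen_x|apply: gen_y]].
Qed.
Lemma comm_ei i a : GRing.comm a (x i) -> GRing.comm a (y i) -> GRing.comm a (ei i).
Proof. by move=> ax ay; apply: commrB; [apply: commr1 | apply: commrM]. Qed.
Lemma gen_comm_ei T i a : i \in T -> gen T a -> GRing.comm a (ei i).
Proof. by move=> iT ga; case: (gen_comm hS iT ga) => *; apply: comm_ei. Qed.
Lemma ei_xS i k : ei i * x i ^+ k.+1 = 0.
Proof. by rewrite exprS mulrA ei_x mul0r. Qed.
Lemma yS_ei i k : y i ^+ k.+1 * ei i = 0.
Proof. by rewrite exprSr -mulrA y_ei mulr0. Qed.
Lemma yXxX i k : y i ^+ k * x i ^+ k = 1.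
Proof.
by elim: k => [|k IH]; rewrite ?mulr1 // exprSr exprS -mulrA [y i * _]mulrA (yx hS) mul1r.
Qed.
Lemma ei_y_x_ei i m k : ei i * y i ^+ m * x i ^+ k * ei i = (m == k)%:R * ei i.
Proof.
have [->|mk] := eqVneq; first by rewrite mul1r -mulrA -mulrA [_ * (_ * ei i)]mulrA yXxX mul1r ei_idem.
rewrite mul0r; case: (ltngtP m k) mk => // mk _.
  rewrite -(subnKC mk) addSn -addnS exprD !mulrA -[_ * y i ^+ m * _]mulrA yXxX mulr1.
  by rewrite ei_xS mul0r.
rewrite -(subnK mk) addnS -addSn exprD -!mulrA [_ ^+ k * _]mulrA yXxX mul1r.
by rewrite yS_ei mulr0.
Qed.

Lemma telescope i k : \sum_(m < k) x i ^+ m * ei i * y i ^+ m = 1 - x i ^+ k * y i ^+ k.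
Proof.
elim: k => [|k IH]; first by rewrite big_ord0 mulr1 subrr.
rewrite big_ord_recr /= IH /ei mulrBr mulr1 mulrBl [in RHS]exprSr [in RHS]exprS.
by rewrite !mulrA addrA subrK.
Qed.

(** By [telescope], 1 is x_i^k y_i^k plus the diagonal matrix units x_i^m e_i y_i^m with m < k, and
    a kills the first term. The same identity serves later for the images of x_i and y_i under an
    automorphism. *)
Lemma expand_killed i k a : a * x i ^+ k = 0 ->
  a = \sum_(m < k) a * x i ^+ m * ei i * y i ^+ m.
Proof.
move=> a0; rewrite -[LHS]mulr1 -[1](subrK (x i ^+ k * y i ^+ k)) -telescope.
rewrite mulrDr [a * (_ * _)]mulrA a0 mul0r addr0 mulr_sumr.
by apply: eq_bigr => m _; rewrite !mulrA.
Qed.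

(** Polynomials over the noncommutative ring A, with coefficients on the left. They are evaluated at
    x_i with i in [T], so that the coefficients commute with x_i, y_i and e_i. *)
Definition coef_span T p : Prop := forall k, gen T p`_k.
Notation gencoef := coef_span.

Lemma gencoef_lin T (k : K) p q :
  gencoef T p -> gencoef T q -> gencoef T (k%:A%:P * p + q).
Proof.
by move=> gp gq m; rewrite coefD coefCM mulr_algl; apply: gen_lin.
Qed.
Lemma gencoefC T a : gen T a -> gencoef T a%:P.
Proof. by move=> ga [|k]; rewrite coefC //=; apply: gen0. Qed.
Lemma gencoefCM T a p : gen T a -> gencoef T p -> gencoef T (a%:P * p).
Proof. by move=> ga gp k; rewrite coefCM; apply: genM. Qed.
Lemma gencoefMX T p : gencoef T p -> gencoef T (p * 'X).
Proof. by move=> gp [|k]; rewrite coefMX //=; apply: gen0. Qed.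
Lemma gencoef_drop T p : gencoef T p -> gencoef T (drop_poly 1 p).
Proof. by move=> gp k; rewrite coef_drop_poly. Qed.
Lemma gencoef_commx T i p : i \in T -> gencoef T p -> GRing.comm (x i) p.[x i].
Proof.
move=> iT gp; rewrite horner_coef; apply: commr_sum => k _.
apply: commrM; last by apply: commrX.
by apply/commr_sym/(gen_commx hS iT).
Qed.
Lemma horner_mulXn p m z : (p * 'X^m).[z] = p.[z] * z ^+ m.
Proof.
elim: m => [|m IH]; first by rewrite !expr0 !mulr1.
by rewrite !exprSr mulrA hornerMX IH mulrA.
Qed.
Lemma drop1_horner p z : p.[z] = (drop_poly 1 p).[z] * z + p`_0.
Proof.
have {1}-> : p = drop_poly 1 p * 'X + (p`_0)%:P.
  by apply/polyP => -[|k]; rewrite coefD coefMX coefC coef_drop_poly ?add0r ?addr0 ?addn1.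
by rewrite hornerMXaddC.
Qed.

(** Two ways to get rid of y_i: a high power of x_i on the right cancels every y_i, and so does e_i
    because y_i e_i = 0. What remains is a polynomial in x_i. *)
Lemma gen_poly T i a : i \notin T -> gen T a ->
  (exists N p, gencoef (i |: T) p /\ a * x i ^+ N = p.[x i]) /\
  (exists p, gencoef (i |: T) p /\ a * ei i = p.[x i] * ei i).
Proof.
move=> iT; have iU : i \in i |: T by rewrite setU11.
elim=> [|k b c _ [[N [p [gp bp]]] [p' [gp' bp']]] _ [[M [q [gq cq]]] [q' [gq' cq']]]
        |j b jT _ [[N [p [gp bp]]] [p' [gp' bp']]]
        |j b jT _ [[N [p [gp bp]]] [p' [gp' bp']]]].
- split; first by exists 0, 1%:P; split; [apply/gencoefC/gen1|rewrite mulr1 hornerC].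
  by exists 1%:P; split; [apply/gencoefC/gen1|rewrite hornerC].
- split; last first.
    exists (k%:A%:P * p' + q'); split; first exact: gencoef_lin.
    by rewrite hornerD hornerCM mulr_algl !mulrDl -!scalerAl bp' cq'.
  have shift r m : gencoef (i |: T) r -> gencoef (i |: T) (r * 'X^m).
    by move=> gr; elim: m => [|m gm]; rewrite ?expr0 ?mulr1 // exprSr mulrA; apply: gencoefMX.
  exists (N + M)%N, (k%:A%:P * (p * 'X^M) + q * 'X^N); split.
    by apply: gencoef_lin; apply: shift.
  rewrite hornerD hornerCM !horner_mulXn -bp -cq mulr_algl mulrDl -scalerAl.
  by rewrite -!mulrA -!exprD [(M + N)%N]addnC.
- have [->|ji] := eqVneq j i.
    split; last first.
      exists (p' * 'X); split; first exact: gencoefMX.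
      by rewrite hornerMX -mulrA bp' mulrA (gencoef_commx iU gp').
    exists N, (p * 'X); split; first exact: gencoefMX.
    by rewrite hornerMX -mulrA bp (gencoef_commx iU gp).
  have gx : gen (i |: T) (x j) by apply: gen_x; rewrite in_setU1 negb_or ji.
  split; last first.
    exists ((x j)%:P * p'); split; first exact: gencoefCM.
    by rewrite hornerCM -!mulrA bp'.
  exists N, ((x j)%:P * p); split; first exact: gencoefCM.
  by rewrite hornerCM -!mulrA bp.
- have [->|ji] := eqVneq j i.
    split; last first.
      (* Left multiplication by y_i lowers degrees by one; the constant term commutes with y_i and
         dies against y_i e_i = 0. *)
      exists (drop_poly 1 p'); split; first exact: gencoef_drop.
      rewrite -mulrA bp' drop1_horner mulrDl mulrDr -(gencoef_commx iU (gencoef_drop gp')).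
      rewrite !mulrA (yx hS) mul1r -(gen_commy hS iU (gp' 0%N)) -mulrA y_ei mulr0 addr0.
      by [].
    exists N.+1, p; split=> //.
    by rewrite exprSr -mulrA [b * _]mulrA bp -(gencoef_commx iU gp) mulrA (yx hS) mul1r.
  have gx : gen (i |: T) (y j) by apply: gen_y; rewrite in_setU1 negb_or ji.
  split; last first.
    exists ((y j)%:P * p'); split; first exact: gencoefCM.
    by rewrite hornerCM -!mulrA bp'.
  exists N, ((y j)%:P * p); split; first exact: gencoefCM.
  by rewrite hornerCM -!mulrA bp.
Qed.
End Corners.

(** * Matrix entries and the ideals P_i *)

Section Ideals.
Variables (K : fieldType) (n : nat) (A : algType K) (x y : 'I_n -> A).
Hypothesis hS : is_Sn x y.
Implicit Types (T : {set 'I_n}) (i j : 'I_n) (a b c : A) (p q : {poly A}).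
Notation gen := (word_span x y).
Notation ei := (defect x y).
Notation gencoef := (coef_span x y).

Lemma ei_inj T i c : i \in T -> gen T c -> c * ei i = 0 -> c = 0.
Proof.
move=> iT gc; rewrite (gen_comm_ei hS iT gc) => /(gen_inj hS iT gc). exact.
Qed.

(** By [ei_y_x_ei] only the term of degree m survives. Coefficients are thus recovered from the
    value at x_i, once [ei_inj] has removed the factor e_i. *)
Lemma coef_extract T i p m : i \in T -> gencoef T p ->
  ei i * y i ^+ m * p.[x i] * ei i = p`_m * ei i.
Proof.
move=> iT gp; rewrite horner_coef mulr_sumr mulr_suml.
have E k : ei i * y i ^+ m * (p`_k * x i ^+ k) * ei i = p`_k * ((m == k)%:R * ei i).
  rewrite -(ei_y_x_ei hS) !mulrA; congr (_ * _ * _).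
  have -> : ei i * y i ^+ m * p`_k = p`_k * (ei i * y i ^+ m); last by rewrite mulrA.
  apply/commr_sym/commrM; first exact: (gen_comm_ei hS iT).
  by apply/commrX/(gen_commy hS iT).
under eq_bigr do rewrite E.
have [mp|pm] := ltnP m (size p).
  rewrite (bigD1 (Ordinal mp)) //= eqxx mul1r big1 ?addr0 // => k km.
  rewrite [m == k]eq_sym (_ : (k == m :> nat) = false) ?mul0r ?mulr0 //.
  by apply/negbTE; apply: contra km => /eqP km; apply/eqP/val_inj.
rewrite nth_default // mul0r big1 // => k _.
by rewrite gtn_eqF ?mul0r ?mulr0 // (leq_trans (ltn_ord k)).
Qed.

Lemma poly_neq0_coef p : p != 0 -> exists m, p`_m != 0.
Proof. by move=> p0; exists (size p).-1; rewrite -/(lead_coef p) lead_coef_eq0. Qed.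

(** Here a is read as an infinite matrix in the variable i. If all columns a x_i^k e_i vanished, the
    polynomial form of a x_i^N would be zero, so x_i^N would kill a and [expand_killed] would give a
    = 0. *)
Lemma gen_entry T i a : i \notin T -> gen T a -> a != 0 ->
  exists k m c, [/\ gen (i |: T) c, c != 0 &
    ei i * y i ^+ m * a * x i ^+ k * ei i = c * ei i].
Proof.
move=> iT ga a0; have iU : i \in i |: T by rewrite setU11.
have [[N [p [gp ap]]] _] := gen_poly hS iT ga.
have [k ak] : exists k, a * x i ^+ k * ei i != 0.
  apply: contrapT => nk.
  have ak k : a * x i ^+ k * ei i = 0.
    by apply/eqP; apply: contraT => akn; case: nk; exists k.
  have p0 m : p`_m = 0.
    apply: (ei_inj iU (gp m)); rewrite -(coef_extract m iU gp) -ap.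
    by rewrite -mulrA ak mulr0.
  have: a * x i ^+ N = 0.
    by rewrite ap horner_coef big1 // => m _; rewrite p0 mul0r.
  move=> /(expand_killed y) aE; case/eqP: a0; rewrite aE big1 // => m _.
  by rewrite ak mul0r.
have [_ [q [gq aq]]] := gen_poly hS iT (genM ga (genX k (gen_x x y iT))).
have q0 : q != 0 by apply: contraNneq ak => q0; rewrite aq q0 horner0 mul0r.
have [m qm] := poly_neq0_coef q0.
exists k, m, q`_m; split=> //.
by rewrite -(coef_extract m iU gq) -!mulrA; congr (_ * (_ * _)); rewrite mulrA aq.
Qed.

Definition defect_prod (s : seq 'I_n) : A := \prod_(i <- s) ei i.
Notation eprod := defect_prod.

Lemma gen_eprod T s : (forall i, i \in s -> i \notin T) -> gen T (eprod s).
Proof.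
elim: s => [|i s IH] h; rewrite /eprod ?big_nil ?big_cons; first exact: gen1.
apply: genM; first by apply: gen_ei; apply: h; rewrite mem_head.
by apply: IH => j js; apply: h; rewrite inE js orbT.
Qed.

Lemma eprod_neq0 s : uniq s -> eprod s != 0.
Proof.
elim: s => [_|i s IH /= /andP[is_ us]]; rewrite /eprod ?big_nil ?big_cons ?oner_neq0 //.
apply: contraNneq (IH us) => es0; apply/eqP; apply: (gen_inj hS (set11 i)) es0.
by apply: gen_eprod => j js; rewrite inE; apply: contraNneq is_ => <-.
Qed.

(** Taking a nonzero entry in one variable after another reduces a to a nonzero scalar, at the price
    of a factor e_i for each variable used. Hence every nonzero two-sided ideal contains the product
    of all e_i. *)
Lemma gen_min s T a : uniq s -> (forall i, (i \in s) = (i \notin T)) ->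
  gen T a -> a != 0 -> exists b d, [/\ gen T b, gen T d & b * a * d = eprod s].
Proof.
elim: s T a => [|i s IH] T a /=.
  move=> _ sT ga a0.
  have TT : T = setT by apply/setP => i; rewrite inE; have := sT i; case: (i \in T).
  have [k aE] : exists k : K, a = k%:A by apply: gen_setT x y _ _; rewrite -TT.
  have k0 : k != 0 by apply: contraNneq a0 => k0; rewrite aE k0 scale0r.
  exists (k^-1)%:A, 1; split; [by apply/genZ/gen1|exact: gen1|].
  by rewrite /eprod big_nil mulr1 mulr_algl aE scalerA mulVf // scale1r.
move=> /andP[is_ us] sT ga a0.
have iT : i \notin T by rewrite -sT mem_head.
have [k [m [c [gc c0 cE]]]] := gen_entry iT ga a0.
have [|b [d [gb gd bcd]]] := IH (i |: T) c us _ gc c0.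
  move=> j; rewrite in_setU1 negb_or -sT inE.
  by case: eqVneq => // ->; apply/negbTE.
have iU : i \in i |: T by rewrite setU11.
have gT := genS (subsetUr [set i] T).
have gi := gen_ei x y iT.
exists (b * (ei i * y i ^+ m)), (x i ^+ k * ei i * d); split.
- by apply: genM; [apply: gT | apply: genM => //; apply/genX/gen_y].
- by apply: genM; [apply: genM => //; apply/genX/gen_x | apply: gT].
have -> : b * (ei i * y i ^+ m) * a * (x i ^+ k * ei i * d) =
          b * (ei i * y i ^+ m * a * x i ^+ k * ei i) * d by rewrite !mulrA.
rewrite cE mulrA -mulrA -(gen_comm_ei hS iU gd) mulrA bcd.
rewrite /eprod big_cons; apply: (gen_comm_ei hS iU).
apply: gen_eprod => j js; rewrite in_setU1 negb_or -sT inE js orbT andbT.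
by apply: contraNneq is_ => <-.
Qed.

Definition torsion i a : Prop := exists N, a * x i ^+ N = 0.
Notation inP := torsion.

Lemma inP_leq i a N M : (N <= M)%N -> a * x i ^+ N = 0 -> a * x i ^+ M = 0.
Proof. by move=> /subnKC <- aN; rewrite exprD mulrA aN mul0r. Qed.
Lemma inP0 i : inP i 0.
Proof. by exists 0; rewrite mul0r. Qed.
Lemma inPD i a b : inP i a -> inP i b -> inP i (a + b).
Proof.
move=> [N aN] [M bM]; exists (N + M)%N; rewrite mulrDl.
by rewrite (inP_leq (leq_addr M N) aN) (inP_leq (leq_addl N M) bM) addr0.
Qed.
Lemma inPMl i a b : inP i b -> inP i (a * b).
Proof. by move=> [N bN]; exists N; rewrite -mulrA bN mulr0. Qed.
(** Every letter except y_i commutes with powers of x_i, and y_i costs one more power. Thus P_i is a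
    two-sided ideal. *)
Lemma inPMr i a b : inP i a -> inP i (a * b).
Proof.
move=> iPa; elim: (gen_all hS b) a iPa => {b} [a|k b c _ IHb _ IHc a iPa|j b _ _ IH a iPa|j b _ _ IH a iPa].
- by rewrite mulr1.
- rewrite mulrDr -scalerAr; apply: inPD; last exact: IHc.
  by rewrite -mulr_algl; apply/inPMl/IHb.
- rewrite mulrA; apply: IH; case: iPa => N aN; exists N.
  by rewrite -mulrA (commrX N (xxC hS j i)) mulrA aN mul0r.
- rewrite mulrA; apply: IH; case: iPa => N aN.
  have [->|ji] := eqVneq j i.
    by exists N.+1; rewrite exprS -mulrA [y i * _]mulrA (yx hS) mul1r.
  exists N; rewrite -mulrA.
  have yxN : GRing.comm (y j) (x i ^+ N) by apply: commrX; rewrite /GRing.comm (xyC hS) // eq_sym.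
  by rewrite yxN mulrA aN mul0r.
Qed.
Lemma inPN i a : inP i a -> inP i (- a).
Proof. by rewrite -mulN1r; apply: inPMl. Qed.
Lemma inPB i a b : inP i a -> inP i b -> inP i (a - b).
Proof. by move=> ia /inPN; apply: inPD. Qed.
Lemma inP_ei i : inP i (ei i).
Proof. by exists 1%N; rewrite (ei_x hS). Qed.
Lemma inP_sum i (I : Type) (r : seq I) (P : pred I) F :
  (forall k, P k -> inP i (F k)) -> inP i (\sum_(k <- r | P k) F k).
Proof. by move=> h; apply: big_ind => //; [apply: inP0|apply: inPD]. Qed.

(** Elements of P_i are sums of terms c x_i^k e_i y_i^m with c free of the index i, and y_i^M kills
    x_i^k e_i as soon as M > k. *)
Lemma inP_killl i a : inP i a -> exists N, forall M, (N <= M)%N -> y i ^+ M * a = 0.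
Proof.
move=> [N aN]; rewrite (expand_killed y aN) {aN}.
elim: N => [|N [M IH]]; first by exists 0 => M _; rewrite big_ord0 mulr0.
have i0 : i \notin set0 by rewrite inE.
have iU : i \in i |: set0 by rewrite setU11.
have [_ [p [gp ap]]] := gen_poly hS i0 (gen_all hS (a * x i ^+ N)).
exists (M + size p)%N => L ML.
rewrite big_ord_recr /= mulrDr IH ?(leq_trans (leq_addr _ _) ML) // add0r.
rewrite ap !mulrA horner_coef mulr_sumr !mulr_suml big1 // => k _.
rewrite mulrA -(commrX L (gen_commy hS iU (gp k))).
have kL : (k < L)%N by apply: leq_trans (ltn_ord k) (leq_trans (leq_addl _ _) ML).
rewrite -(subnK kL) addnS -addSn exprD -!mulrA [_ ^+ k * (_ * _)]mulrA (yXxX hS) mul1r.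
by rewrite [_ * (ei i * _)]mulrA (yS_ei hS) mul0r mulr0.
Qed.

(** For i different from j, e_i commutes with x_j, whose powers are left cancellable, so P_j cannot
    contain e_i. *)
Lemma inP_ei_eq i j : inP j (ei i) -> i = j.
Proof.
move=> [N eN]; have [//|ij] := eqVneq i j.
have ji : i \notin [set j] by rewrite inE.
have e0 : ei i != 0 by have := @eprod_neq0 [:: i] isT; rewrite /eprod big_seq1.
case/eqP: e0; rewrite -[LHS]mul1r -(yXxX hS j N) -mulrA.
have -> : x j ^+ N * ei i = ei i * x j ^+ N.
  by apply/commr_sym/commrX; apply: (gen_commx hS (set11 j)); apply: gen_ei.
by rewrite eN mulr0.
Qed.
End Ideals.

(** * An automorphism close to the identity preserves every P_i *)

Section Primes.
Variables (K : fieldType) (n : nat) (A : algType K) (x y : 'I_n -> A).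
Hypothesis hS : is_Sn x y.
Implicit Types (T : {set 'I_n}) (i j : 'I_n) (a b c : A) (p q : {poly A}).
Notation gen := (word_span x y).
Notation ei := (defect x y).
Notation eprod := (defect_prod x y).
Notation inP := (torsion x).
Notation gencoef := (coef_span x y).

Lemma eprod_idem s : uniq s -> eprod s * eprod s = eprod s.
Proof.
elim: s => [_|i s IH /= /andP[is_ us]]; rewrite /eprod ?big_nil ?mulr1 // !big_cons.
rewrite -/(defect_prod x y s).
have cE : eprod s * ei i = ei i * eprod s.
  apply: (gen_comm_ei hS (set11 i)); apply: gen_eprod => j js.
  by rewrite inE; apply: contraNneq is_ => <-.
by rewrite -mulrA [eprod s * _]mulrA cE !mulrA (ei_idem hS) -mulrA IH.
Qed.

(** * Primeness of P_j *)

Section Lowest.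
Variable j : 'I_n.
Let s := enum (~: [set j]).
Let s_uniq : uniq s. Proof. exact: enum_uniq. Qed.
Let sE i : (i \in s) = (i \notin [set j]).
Proof. by rewrite mem_enum inE. Qed.
Let gen_es : gen [set j] (eprod s).
Proof. by apply: gen_eprod => i; rewrite sE. Qed.

(* Up to multiplication by elements of A, an element outside P_j has the shape
   e + r x_j with e the product of the e_i, i <> j: a polynomial in x_j with lowest
   coefficient e.  Such elements are closed under product, so P_j is prime. *)
Definition lowest_one a : Prop := exists r,
  [/\ a = eprod s + r * x j, eprod s * r = r, r * eprod s = r & GRing.comm r (x j)].

Lemma lowest_oneM a b : lowest_one a -> lowest_one b -> lowest_one (a * b).
Proof.
have ee := eprod_idem s_uniq; have ex := gen_commx hS (set11 j) gen_es.
move=> [r [-> er re rx]] [t [-> et te tx]]; exists (t + r + r * x j * t); split.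
- rewrite mulrDl !mulrDr ee !mulrDl mulrA et -[r * x j * eprod s]mulrA -ex mulrA re.
  by rewrite !mulrA -!addrA; congr (_ + _); rewrite addrA.
- by rewrite !mulrDr et er !mulrA er.
- by rewrite !mulrDl te re -!mulrA te.
- by apply/commr_sym/commrD; [apply/commrD; exact: commr_sym|];
    apply: commrM; [apply: commrM|]; try exact: commr_sym.
Qed.

(** Such an element commutes with x_j; cancelling x_j^N by y_j^N and multiplying by e_j would make
    the product of all e_i vanish. *)
Lemma lowest_one_notin a : lowest_one a -> ~ inP j a.
Proof.
have ex := gen_commx hS (set11 j) gen_es.
move=> [r [-> er re rx]] [N].
have -> : (eprod s + r * x j) * x j ^+ N = x j ^+ N * (eprod s + r * x j).
  by apply/commr_sym/commrD; [|apply: commrM => //];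
    apply/commr_sym/commrX => //; apply: commr_refl.
move=> /(congr1 (fun z => ei j * y j ^+ N * z)); rewrite mulr0 mulrA.
rewrite -[_ * y j ^+ N * _]mulrA (yXxX hS) mulr1 rx mulrDr mulrA (ei_x hS) mul0r addr0.
apply/eqP; have := @eprod_neq0 _ _ _ _ _ hS (j :: s).
rewrite /= s_uniq sE set11 /= => /(_ isT).
by rewrite /defect_prod big_cons.
Qed.

(** Clear y_j by x_j^N, divide by the lowest power x_j^k by means of y_j^k, and turn the lowest
    coefficient into e by [gen_min] in the other variables. The outer factors e secure e r = r = r
    e. *)
Lemma lowest_one_sandwich a : ~ inP j a -> exists b d, lowest_one (b * a * d).
Proof.
move=> aP.
have j0 : j \notin set0 by rewrite inE.
have [[N [p [gp ap]]] _] := gen_poly hS j0 (gen_all hS a).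
rewrite setU0 in gp.
have ex_m : exists m, p`_m != 0.
  apply: poly_neq0_coef; apply: contra_notN aP => /eqP p0.
  by exists N; rewrite ap p0 horner0.
case: (ex_minnP ex_m) => k pk kmin.
pose q := drop_poly k p.
have gq : gencoef [set j] q by move=> m; rewrite coef_drop_poly.
have pE : p = q * 'X^k.
  rewrite -[LHS](poly_take_drop k) -[RHS]add0r; congr (_ + _).
  apply/polyP => m; rewrite coef_take_poly coef0; case: ltnP => // mk.
  by apply/eqP; apply: contraTT mk => /kmin; rewrite -leqNgt.
have q0 : q`_0 != 0 by rewrite coef_drop_poly add0n.
have [b [d [gb gd bd]]] := gen_min hS s_uniq sE (gq 0%N) q0.
pose q' := drop_poly 1 q.
have gq' : gencoef [set j] q' by apply: gencoef_drop.
exists (eprod s * b * y j ^+ k), (x j ^+ N * d * eprod s), (eprod s * (b * q'.[x j] * d) * eprod s).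
have ee := eprod_idem s_uniq.
have xc c : gen [set j] c -> GRing.comm (x j) c.
  by move=> /(gen_commx hS (set11 j)) /commr_sym.
have xq' : GRing.comm (x j) q'.[x j] by apply: (gencoef_commx hS (set11 j) gq').
split.
- have -> : eprod s * b * y j ^+ k * a * (x j ^+ N * d * eprod s)
          = eprod s * b * (y j ^+ k * (a * x j ^+ N)) * d * eprod s by rewrite !mulrA.
  rewrite ap pE horner_mulXn.
  have xq := gencoef_commx hS (set11 j) gq.
  rewrite (commrX k (commr_sym xq)) [y j ^+ k * _]mulrA (yXxX hS) mul1r.
  rewrite (@drop1_horner _ _ q) -/q' addrC mulrDr !mulrDl.
  have -> : eprod s * b * q`_0 * d * eprod s = eprod s * (b * q`_0 * d) * eprod s.
    by rewrite !mulrA.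
  rewrite bd ee ee; congr (_ + _); rewrite -!mulrA; congr (_ * (_ * (_ * _))).
  have xde : GRing.comm (x j) (d * eprod s) by apply: commrM; apply: xc.
  by rewrite xde mulrA.
- by rewrite !mulrA ee.
- by rewrite -!mulrA ee.
- apply/commr_sym; do ?apply: commrM => //; exact: xc.
Qed.

Lemma inP_prime a b : ~ inP j a -> ~ inP j b -> exists c, ~ inP j (a * c * b).
Proof.
move=> /lowest_one_sandwich[u [v l1]] /lowest_one_sandwich[u' [v' l2]].
exists (v * u') => acb; apply: (lowest_one_notin (lowest_oneM l1 l2)).
have -> : u * a * v * (u' * b * v') = u * (a * (v * u') * b) * v' by rewrite !mulrA.
by apply: (inPMr hS); apply: inPMl.
Qed.
End Lowest.

(** * Images of the ideals P_i under an automorphism close to the identity *)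

Section Automorphism.
Variable s : A -> A.
Hypothesis s_aut : is_alg_aut s.
Hypothesis sxP : forall i, inP i (s (x i) - x i).
Hypothesis syP : forall i, inP i (s (y i) - y i).

Lemma alg_morphX (f : A -> A) : alg_morph f -> forall a k, f (a ^+ k) = f a ^+ k.
Proof. by move=> [_ f1 fM] a; elim=> [|k IH]; rewrite ?expr0 // !exprS fM IH. Qed.
Lemma alg_morph0 (f : A -> A) : alg_morph f -> f 0 = 0.
Proof.
move=> [fl _ _]; have := fl (-1) 0 0.
by rewrite scaler0 addr0 => ->; rewrite scaleN1r addNr.
Qed.
Lemma alg_morphD (f : A -> A) : alg_morph f -> forall a b, f (a + b) = f a + f b.
Proof. by move=> [fl _ _] a b; have := fl 1 a b; rewrite !scale1r. Qed.

Let s_mor : alg_morph s. Proof. by case: s_aut. Qed.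
Let sM a b : s (a * b) = s a * s b. Proof. by case: s_mor. Qed.
Let s_surj a : exists b, a = s b.
Proof. by case: s_aut => _ [g _ gK]; exists (g a). Qed.
Let s_inj : injective s. Proof. by case: s_aut => _ /bij_inj. Qed.

Definition inQ i a := exists b, inP i b /\ a = s b.

Lemma inQD i a b : inQ i a -> inQ i b -> inQ i (a + b).
Proof.
move=> [a' [a'P ->]] [b' [b'P ->]]; exists (a' + b').
by split; [apply: inPD|rewrite alg_morphD].
Qed.
Lemma inQMl i a b : inQ i b -> inQ i (a * b).
Proof.
have [a' ->] := s_surj a.
by move=> [b' [b'P ->]]; exists (a' * b'); split; [apply: inPMl|].
Qed.
Lemma inQMr i a b : inQ i a -> inQ i (a * b).
Proof.
have [b' ->] := s_surj b.
by move=> [a' [a'P ->]]; exists (a' * b'); split; [apply: (inPMr hS)|].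
Qed.
Lemma inQ0 i : inQ i 0.
Proof. by exists 0; split; [apply: inP0|rewrite alg_morph0]. Qed.
Lemma inQ_prime i a b : (forall c, inQ i (a * c * b)) -> inQ i a \/ inQ i b.
Proof.
have [a' ->] := s_surj a; have [b' ->] := s_surj b => acb.
have [aP|aP] := pselect (inP i a'); first by left; exists a'.
have [bP|bP] := pselect (inP i b'); first by right; exists b'.
have [c []] := inP_prime aP bP.
have [d [dP]] := acb (s c); rewrite -!sM => /s_inj dE.
by rewrite dE.
Qed.

(** Expanding along sigma(x_i), sigma(y_i) by [expand_killed] brings in the factor 1 - sigma(x_i)
    sigma(y_i), which differs from e_i by elements of P_i. *)
Lemma inQ_inP i a : inQ i a -> inP i a.
Proof.
move=> [b [[N bN] ->]].
have : s b * s (x i) ^+ N = 0 by rewrite -alg_morphX // -sM bN alg_morph0.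
move=> /(@expand_killed _ _ _ (s \o x) (s \o y)) ->.
apply: inP_sum => k _; apply: (inPMr hS); apply: inPMl.
rewrite /defect /=.
have -> : 1 - s (x i) * s (y i) = ei i - (s (x i) - x i) * s (y i) - x i * (s (y i) - y i).
  rewrite -{1}(subrK (x i) (s (x i))) mulrDl -{2}(subrK (y i) (s (y i))) mulrDr !opprD /defect.
  by rewrite -!addrA; congr +%R; rewrite [LHS]addrA [LHS]addrC.
apply: inPB; last exact: inPMl.
by apply: inPB; [apply: inP_ei | apply: (inPMr hS)].
Qed.

(** The nonzero ideal sigma(P_i) contains the product of all e_k, hence one e_k, being prime. As
    sigma(P_i) lies in P_i, that k is i. *)
Lemma inQ_ei i : inQ i (ei i).
Proof.
have [e Ee] : exists e, e != 0 /\ inQ i e.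
  exists (s (ei i)); split; last by exists (ei i); split=> //; apply: inP_ei.
  have e0 : ei i != 0.
    by have := @eprod_neq0 _ _ _ _ _ hS [:: i] isT; rewrite /defect_prod big_seq1.
  by apply: contraNneq e0 => se; apply/eqP/s_inj; rewrite se (alg_morph0 s_mor).
case: Ee => e0 eQ.
have [|b [d [_ _ bd]]] :=
    gen_min hS (enum_uniq 'I_n) (T := set0) _ (gen_all hS e) e0.
  by move=> k; rewrite mem_enum !inE.
have : inQ i (eprod (enum 'I_n)) by rewrite -bd; apply/inQMr/inQMl.
elim: (enum 'I_n) (enum_uniq 'I_n) => [_|k r IH /= /andP[kr ur]]; rewrite /defect_prod ?big_nil ?big_cons.
  by move=> Q1; rewrite -[ei i]mulr1; apply: inQMl.
have ck : GRing.comm (eprod r) (ei k).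
  apply: (gen_comm_ei hS (set11 k)); apply: gen_eprod => l lr.
  by rewrite inE; apply: contraNneq kr => <-.
have cxk : GRing.comm (eprod r) (x k).
  apply: (gen_commx hS (set11 k)); apply: gen_eprod => l lr.
  by rewrite inE; apply: contraNneq kr => <-.
rewrite -/(defect_prod x y r) -ck => Q.
(* Primeness asks for an arbitrary c between the factors. Since c e_k is a polynomial in x_k times
   e_k, its powers of x_k and its coefficients can be moved outside the product. *)
suff prem : forall c, inQ i (eprod r * c * ei k).
  case: (inQ_prime prem) => [/(IH ur)//|ekQ].
  by have ki := inP_ei_eq hS (inQ_inP ekQ); move: ekQ; rewrite ki.
move=> c.
have k0 : k \notin set0 by rewrite inE.
have kU : k \in k |: set0 by rewrite setU11.
have [_ [p [gp cp]]] := gen_poly hS k0 (gen_all hS c).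
rewrite -mulrA cp horner_coef mulr_suml mulr_sumr.
apply: big_ind => [||m _]; [exact: inQ0|exact: inQD|].
have -> : eprod r * (p`_m * x k ^+ m * ei k) = x k ^+ m * (eprod r * ei k) * p`_m.
  rewrite (commrX m (gen_commx hS kU (gp m))) -[in LHS]mulrA (gen_comm_ei hS kU (gp m)).
  by rewrite !mulrA (commrX m cxk).
by apply: inQMr; apply: inQMl.
Qed.

(** With e_i in sigma(P_i), the expansion of a puts it in sigma(P_i). So a = sigma(b) with b killed
    by high powers of x_i on the right and of y_i on the left. *)
Lemma killed_by_image i a : inP i a ->
  exists N, forall M, (N <= M)%N -> a * s (x i) ^+ M = 0 /\ s (y i) ^+ M * a = 0.
Proof.
move=> [N aN].
have : inQ i a.
  rewrite (expand_killed y aN); apply: big_ind => [||m _]; [exact: inQ0|exact: inQD|].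
  by apply: inQMr; apply: inQMl; apply: inQ_ei.
move=> [b [[L bL] bE]].
have [L' bL'] : exists N, forall M, (N <= M)%N -> y i ^+ M * b = 0.
  by apply: (inP_killl hS); exists L.
exists (L + L')%N => M LM; rewrite bE -!(alg_morphX s_mor) -!sM.
rewrite bL' ?(leq_trans (leq_addl _ _) LM) //.
by rewrite (inP_leq (leq_trans (leq_addr _ _) LM) bL) !(alg_morph0 s_mor).
Qed.
End Automorphism.
End Primes.

(** * Intertwining two Toeplitz pairs *)

(* To be read with G the subalgebra S_{j} and F = F({j}), isomorphic to M_oo(K).
   The conditions are stable under passage to the converse ring with X and Y
   exchanged. *)
Record toeplitz_pair (R : nzRingType) (G F : R -> Prop) (X Y X' Y' : R) : Prop := {
  tpYX : Y * X = 1;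
  tpYX' : Y' * X' = 1;
  tpG1 : G 1;
  tpGM : forall a b, G a -> G b -> G (a * b);
  tpGX : G X; tpGY : G Y; tpGX' : G X'; tpGY' : G Y';
  tpFG : forall a, F a -> G a;
  tpFD : forall a b, F a -> F b -> F (a + b);
  tpFN : forall a, F a -> F (- a);
  tpFMl : forall a b, G a -> F b -> F (a * b);
  tpFMr : forall a b, F a -> G b -> F (a * b);
  tpX : F (X' - X);
  tpY : F (Y' - Y);
  tpe : F (1 - X * Y);
  tp_kill : forall h, F h -> exists N, forall M, (N <= M)%N ->
    [/\ h * X ^+ M = 0, Y ^+ M * h = 0, h * X' ^+ M = 0 & Y' ^+ M * h = 0];
  tp_ded : forall a b, F a -> F b -> (1 + a) * (1 + b) = 1 -> (1 + b) * (1 + a) = 1;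
  tp_neq0 : 1 - X * Y != 0;
  tp_right : forall h, F h -> h != 0 -> h * X = 0 -> exists b, b * h = 1 - X * Y;
  tp_left : forall h, F h -> h != 0 -> Y * h = 0 -> exists b, h * b = 1 - X * Y
}.

Section Half.
Variables (R : nzRingType) (G F : R -> Prop) (X Y X' Y' : R).
Hypothesis tp : toeplitz_pair G F X Y X' Y'.

Let e := 1 - X * Y.
Let e' := 1 - X' * Y'.
Let FD := tpFD tp.
Let FN := tpFN tp.
Let FMl := tpFMl tp.
Let FMr := tpFMr tp.

Lemma leftinvX (U V : R) k : V * U = 1 -> V ^+ k * U ^+ k = 1.
Proof.
move=> VU; elim: k => [|k IH]; rewrite ?mulr1 // exprSr exprS.
by rewrite -mulrA [V * _]mulrA VU mul1r.
Qed.
Lemma leftinvXge (U V : R) k m : V * U = 1 -> (k <= m)%N ->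
  V ^+ k * U ^+ m = U ^+ (m - k).
Proof. by move=> VU km; rewrite -{1}(subnKC km) exprD mulrA leftinvX // mul1r. Qed.
Lemma leftinvXle (U V : R) k m : V * U = 1 -> (m <= k)%N ->
  V ^+ k * U ^+ m = V ^+ (k - m).
Proof. by move=> VU km; rewrite -{1}(subnK km) exprD -mulrA leftinvX // mulr1. Qed.
Lemma defect_mul (U V : R) : V * U = 1 -> (1 - U * V) * U = 0.
Proof. by move=> VU; rewrite mulrBl mul1r -mulrA VU mulr1 subrr. Qed.

Lemma tpGexp a k : G a -> G (a ^+ k).
Proof.
by move=> ga; elim: k => [|k IH]; rewrite ?expr0 ?exprS; [apply: (tpG1 tp)|apply: (tpGM tp)].
Qed.
Lemma tpF0 : F 0.
Proof. by rewrite -(addrN (X' - X)); apply: (tpFD tp); [|apply: (tpFN tp)]; apply: (tpX tp). Qed.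
Lemma tpe' : F e'.
Proof.
have -> : e' = e - (X' - X) * Y' - X * (Y' - Y).
  rewrite /e' -{1}(subrK X X') mulrDl -{2}(subrK Y Y') mulrDr !opprD /e.
  by rewrite -!addrA; congr +%R; rewrite [LHS]addrA [LHS]addrC.
apply: FD; last by apply/FN/FMl; [apply: tpGX tp|apply: tpY tp].
apply: FD; first exact: tpe tp.
by apply/FN/FMr; [apply: tpX tp|apply: tpGY' tp].
Qed.
Lemma tpXexp k : F (X' ^+ k - X ^+ k).
Proof.
elim: k => [|k IH]; first by rewrite subrr; apply: tpF0.
rewrite !exprS (_ : _ - _ = (X' - X) * X' ^+ k + X * (X' ^+ k - X ^+ k)).
  apply: FD; first by apply: FMr; [apply: tpX tp|apply/tpGexp/(tpGX' tp)].
  by apply: FMl => //; apply: tpGX tp.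
by rewrite mulrBl mulrBr addrA subrK.
Qed.
Lemma tpYexp k : F (Y' ^+ k - Y ^+ k).
Proof.
elim: k => [|k IH]; first by rewrite subrr; apply: tpF0.
rewrite !exprS (_ : _ - _ = (Y' - Y) * Y' ^+ k + Y * (Y' ^+ k - Y ^+ k)).
  apply: FD; first by apply: FMr; [apply: tpY tp|apply/tpGexp/(tpGY' tp)].
  by apply: FMl => //; apply: tpGY tp.
by rewrite mulrBl mulrBr addrA subrK.
Qed.

(** If X' and Y' were mutually inverse, Y X' and Y' X would be elements of 1 + F with product 1.
    Dedekind finiteness reverses the order and yields X Y = 1. *)
Lemma tpe'_neq0 : e' != 0.
Proof.
have YX := tpYX tp; have YX' := tpYX' tp.
apply: contraNneq (tp_neq0 tp) => e'0.
have XY' : 1 = X' * Y' by apply/eqP; rewrite -subr_eq0 -/e' e'0.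
have FYX' : F (Y * X' - 1) by rewrite -YX -mulrBr; apply: FMl (tpGY tp) (tpX tp).
have FYX : F (Y' * X - 1).
  by rewrite -YX -mulrBl; apply: FMr (tpY tp) (tpGX tp).
have E : Y' * X * (Y * X') = 1.
  have := tp_ded tp FYX' FYX; rewrite ![1 + _]addrC !subrK; apply.
  by rewrite mulrA -[_ * X' * _]mulrA -XY' mulr1 YX.
rewrite subr_eq0 {1}XY'.
have -> : X * Y = X' * (Y' * X * (Y * X')) * Y'.
  by rewrite !mulrA -XY' mul1r -!mulrA -XY' mulr1.
by rewrite E mulr1.
Qed.

(* With m least such that e' Y'^m X^N <> 0, the element u = Y'^m X^N satisfies
   X' u = u X and is invertible.  Modulo F it is X^(N-m) or Y^(m-N), and Dedekind
   finiteness of 1 + F forces m = N. *)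
Lemma half_intertwiner : exists u w,
  [/\ F (u - 1), F (w - 1), u * w = 1, w * u = 1 & X' * u = u * X].
Proof.
have YX := tpYX tp; have YX' := tpYX' tp.
have eX' : e' * X' = 0 by apply: defect_mul.
(* Next to powers of exponent at least N, primed and unprimed letters can be exchanged, and e' is
   killed on the right. *)
have [N kill] : exists N, forall M, (N <= M)%N ->
   [/\ X' * X ^+ M = X ^+ M.+1, Y ^+ M * Y' = Y ^+ M.+1, e' * X ^+ M = 0,
    X * X' ^+ M = X' ^+ M.+1 & Y' ^+ M * Y = Y' ^+ M.+1].
  have [N1 k1] := tp_kill tp (tpX tp).
  have [N2 k2] := tp_kill tp (tpY tp).
  have [N3 k3] := tp_kill tp tpe'.
  exists (N1 + (N2 + N3))%N => M NM.
  have [a1 _ a2 _] := k1 M (leq_trans (leq_addr _ _) NM).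
  have NM' := leq_trans (leq_addl _ _) NM.
  have [_ b1 _ b2] := k2 M (leq_trans (leq_addr _ _) NM').
  have [c1 _ _ _] := k3 M (leq_trans (leq_addl _ _) NM').
  split=> //; apply/eqP; rewrite -subr_eq0.
  - by rewrite exprS -mulrBl a1.
  - by rewrite exprSr -mulrBr b1.
  - by rewrite exprS -mulrBl -opprB mulNr a2 oppr0.
  - by rewrite exprSr -mulrBr -opprB mulrN b2 oppr0.
have Y'Y M k : (N <= M)%N -> Y' ^+ M * Y ^+ k = Y' ^+ (M + k).
  move=> NM; elim: k => [|k IH]; rewrite ?mulr1 ?addn0 // exprSr mulrA IH addnS.
  by have [_ _ _ _ ->] := kill (M + k)%N (leq_trans NM (leq_addr _ _)).
have YY' M k : (N <= M)%N -> Y ^+ M * Y' ^+ k = Y ^+ (M + k).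
  move=> NM; elim: k => [|k IH]; rewrite ?mulr1 ?addn0 // exprSr mulrA IH addnS.
  by have [_ -> _ _ _] := kill (M + k)%N (leq_trans NM (leq_addr _ _)).
have XX' M k : (N <= M)%N -> X ^+ k * X' ^+ M = X' ^+ (M + k).
  move=> NM; elim: k => [|k IH]; rewrite ?mul1r ?addn0 // exprS -mulrA IH addnS.
  by have [_ _ _ -> _] := kill (M + k)%N (leq_trans NM (leq_addr _ _)).
pose r k := e' * Y' ^+ k * X ^+ N.
have rX k : r k.+1 * X = r k.
  have [h _ _ _ _] := kill N (leqnn N).
  by rewrite /r -mulrA -exprSr -h exprSr -!mulrA [Y' * _]mulrA YX' mul1r.
have rE k : (N + N <= k)%N -> r k = e' * Y' ^+ (k - N).
  move=> Nk; have NkN : (N <= k - N)%N by rewrite leq_subRL ?(leq_trans (leq_addr _ _) Nk).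
  rewrite /r -{1}(subnK (leq_trans (leq_addr _ _) Nk)) -Y'Y // -!mulrA.
  by rewrite leftinvX // mulr1.
(* r (2N) is e' Y'^N, nonzero because X'^N cancels Y'^N. This also bounds m by 2N, so that [L] below
   is a true difference. *)
have ex_m : exists m, r m != 0.
  exists (N + N)%N; rewrite rE // addnK.
  apply: contraNneq tpe'_neq0 => /(congr1 (fun z => z * X' ^+ N)).
  by rewrite mul0r -mulrA leftinvX // mulr1 => ->.
case: (ex_minnP ex_m) => m rm mmin.
have m2N : (m <= N + N)%N.
  apply: mmin; rewrite rE // addnK.
  apply: contraNneq tpe'_neq0 => /(congr1 (fun z => z * X' ^+ N)).
  by rewrite mul0r -mulrA leftinvX // mulr1 => ->.
have r0 k : (k < m)%N -> r k = 0.
  by move=> km; apply/eqP; apply: contraTT km => /mmin; rewrite -leqNgt.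
have m_gt0 : (0 < m)%N.
  case: (posnP m) rm => // ->; rewrite /r mulr1.
  by have [_ _ -> _ _] := kill N (leqnn N); rewrite eqxx.
have rmX : r m * X = 0 by rewrite -(prednK m_gt0) rX r0 // prednK.
have [u uDef] : exists u, u = Y' ^+ m * X ^+ N by exists (Y' ^+ m * X ^+ N).
have X'u : X' * u = u * X.
  have -> : X' * u = (1 - e') * (Y' ^+ m.-1 * X ^+ N).
    by rewrite /e' opprB addrC subrK uDef -(prednK m_gt0) exprS !mulrA.
  rewrite mulrBl mul1r mulrA -/(r _) r0 ?prednK // subr0.
  rewrite uDef -mulrA -exprSr; have [<- _ _ _ _] := kill N (leqnn N).
  by rewrite -{2}(prednK m_gt0) exprSr -!mulrA [Y' * _]mulrA YX' mul1r.
pose L := (N + N - m)%N; have [w wDef] : exists w, w = Y ^+ L * X' ^+ N by exists (Y ^+ L * X' ^+ N).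
have uX' : u * X' ^+ N = X' ^+ L.
  rewrite uDef -mulrA XX' // leftinvXge //.
(* r m is nonzero and killed by X, so e is a left multiple of it: whatever r m annihilates, e
   annihilates. *)
have [b br] : exists b, b * r m = e.
  apply: (tp_right tp) => //; rewrite /r -mulrA; apply: FMr; first exact: tpe'.
  by apply: (tpGM tp); apply: tpGexp; [apply: tpGY' tp|apply: tpGX tp].
(* Starting from u X'^N = X'^L, one factor X' is cancelled on the left at each step; k = L exhibits
   w as a right inverse of u. *)
have uw k : (k <= L)%N -> X' ^+ (L - k) = u * (Y ^+ k * X' ^+ N).
  elim: k => [|k IH kL]; first by rewrite subn0 mul1r uX'.
  have kL' : (k <= L)%N by apply: ltnW.
  have e'XL : e' * X' ^+ (L - k) = 0.
    by rewrite -(subnSK kL) exprS mulrA eX' mul0r.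
  have e'u : e' * u = r m by rewrite uDef mulrA.
  have re : r m * e = r m by rewrite mulrBr mulr1 mulrA rmX mul0r subr0.
  have E : e * (Y ^+ k * X' ^+ N) = 0.
    have h : r m * e * (Y ^+ k * X' ^+ N) = 0.
      by rewrite re -e'u -mulrA -(IH kL') e'XL.
    by rewrite -{1}br -re -mulrA h mulr0.
  have ZE : Y ^+ k * X' ^+ N = X * (Y ^+ k.+1 * X' ^+ N).
    apply/eqP; rewrite -subr_eq0 [Y ^+ k.+1]exprS -[Y * _ * _]mulrA mulrA.
    by rewrite -{1}[_ * X' ^+ N]mul1r -mulrBl E.
  have := IH kL'; rewrite ZE mulrA -X'u -(subnSK kL) exprS -mulrA.
  move=> /(congr1 (fun z => Y' * z)).
  by rewrite mulrA [RHS]mulrA YX' !mul1r.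
have uw1 : u * w = 1 by rewrite wDef -(uw L (leqnn L)) subnn.
have YNu : Y ^+ N * u = Y ^+ m.
  by rewrite uDef mulrA YY' // leftinvXle ?leq_addr // addKn.
(* Here u X^k z = X'^k u z = 0 for all k, while Y^N u X^m = 1 forces z = 0. *)
have wu1 : w * u = 1.
  apply/eqP; rewrite eq_sym -subr_eq0; set z := 1 - _.
  have uz : u * z = 0 by rewrite mulrBr mulr1 mulrA uw1 mul1r subrr.
  have uXz k : u * X ^+ k * z = 0.
    have -> : u * X ^+ k = X' ^+ k * u.
      elim: k => [|k IH]; first by rewrite mulr1 mul1r.
      by rewrite exprS mulrA -X'u -mulrA IH mulrA -exprS.
    by rewrite -mulrA uz mulr0.
  have := uXz m => /(congr1 (fun t => Y ^+ N * t)).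
  by rewrite mulr0 !mulrA YNu leftinvX // mul1r => ->.
have [h hDef] : exists h, h = u - Y ^+ m * X ^+ N by exists (u - Y ^+ m * X ^+ N).
have [h' h'Def] : exists h', h' = w - Y ^+ L * X ^+ N by exists (w - Y ^+ L * X ^+ N).
have Fh : F h.
  by rewrite hDef uDef -mulrBl; apply: FMr; [apply: tpYexp|apply/tpGexp/(tpGX tp)].
have Fh' : F h'.
  by rewrite h'Def wDef -mulrBr; apply: FMl; [apply/tpGexp/(tpGY tp)|apply: tpXexp].
have XYd d : (0 < d)%N -> X ^+ d * Y ^+ d <> 1.
  move=> d0 /(congr1 (fun t => e * t)); rewrite mulr1 -(prednK d0) exprS !mulrA.
  rewrite /e defect_mul // !mul0r => e0; case/eqP: (tp_neq0 tp); exact/esym.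
have GXe k := tpGexp k (tpGX tp); have GYe k := tpGexp k (tpGY tp).
(* If m and N differ by d > 0, then u and w are X^d and Y^d modulo F, in one order or the other.
   Dedekind finiteness then gives X^d Y^d = 1, which is excluded by [XYd]. *)
case: (ltngtP m N) => mN.
- pose d := (N - m)%N; have d0 : (0 < d)%N by rewrite subn_gt0.
  have uE : u = X ^+ d + h.
    by rewrite hDef leftinvXge ?(ltnW mN) // addrC subrK.
  have wE : w = Y ^+ d + h'.
    have -> : d = (L - N)%N by rewrite /d /L; lia.
    have NL : (N <= L)%N by rewrite /L; lia.
    by rewrite h'Def leftinvXle // addrC subrK.
  have := tp_ded tp (FMl (GYe d) Fh) (FMr Fh' (GXe d)).
  have -> : 1 + Y ^+ d * h = Y ^+ d * u by rewrite uE mulrDr leftinvX.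
  have -> : 1 + h' * X ^+ d = w * X ^+ d by rewrite wE mulrDl leftinvX.
  rewrite mulrA -[_ * u * w]mulrA uw1 mulr1 leftinvX // => /(_ erefl) E.
  case: (XYd d d0); rewrite -[LHS]mul1r -uw1.
  have -> : u * w * (X ^+ d * Y ^+ d) = u * (w * X ^+ d * (Y ^+ d * u)) * w.
    by rewrite -!mulrA uw1 mulr1.
  by rewrite E mulr1.
- pose d := (m - N)%N; have d0 : (0 < d)%N by rewrite subn_gt0.
  have uE : u = Y ^+ d + h.
    by rewrite hDef leftinvXle ?(ltnW mN) // addrC subrK.
  have wE : w = X ^+ d + h'.
    have -> : d = (N - L)%N by rewrite /d /L; lia.
    have NL : (L <= N)%N by rewrite /L; lia.
    by rewrite h'Def leftinvXge // addrC subrK.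
  have := tp_ded tp (FMl (GYe d) Fh') (FMr Fh (GXe d)).
  have -> : 1 + Y ^+ d * h' = Y ^+ d * w by rewrite wE mulrDr leftinvX.
  have -> : 1 + h * X ^+ d = u * X ^+ d by rewrite uE mulrDl leftinvX.
  rewrite mulrA -[_ * w * u]mulrA wu1 mulr1 leftinvX // => /(_ erefl) E.
  case: (XYd d d0); rewrite -[LHS]mul1r -wu1.
  have -> : w * u * (X ^+ d * Y ^+ d) = w * (u * X ^+ d * (Y ^+ d * w)) * u.
    by rewrite -!mulrA wu1 mulr1.
  by rewrite E mulr1.
have LN : L = N by rewrite /L mN addnK.
exists u, w; split=> //.
  by move: Fh; rewrite hDef mN leftinvX.
by move: Fh'; rewrite h'Def LN leftinvX.
Qed.
End Half.

Lemma exprc (R : nzRingType) (a : R) k : (a : R^c) ^+ k = a ^+ k.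
Proof. by elim: k => // k IH; rewrite exprS exprSr -IH. Qed.

Lemma toeplitz_pair_conv (R : nzRingType) (G F : R -> Prop) (X Y X' Y' : R) :
  toeplitz_pair G F X Y X' Y' ->
  @toeplitz_pair R^c G F (Y : R^c) (X : R^c) (Y' : R^c) (X' : R^c).
Proof.
move=> tp; have [? ? ? GM ? ? ? ? ? ? ? Fl Fr ? ? ? kl dd ? rt lt] := tp.
split=> //.
- by move=> a b ga gb; apply: GM.
- by move=> a b ga gb; apply: Fr.
- by move=> a b ga gb; apply: Fl.
- move=> h /kl [N hN]; exists N => M /hN [h1 h2 h3 h4].
  by rewrite !exprc; split.
- by move=> a b Fa Fb; apply: dd.
Qed.

(* The converse ring gives v with v Y' = Y v.  Then c = v u satisfies Y c X = c and
   lies in 1 + F, so that c = 1. *)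
Lemma toeplitz_intertwiner (R : nzRingType) (G F : R -> Prop) (X Y X' Y' : R) :
  toeplitz_pair G F X Y X' Y' ->
  exists u w, [/\ F (u - 1), F (w - 1), u * w = 1, w * u = 1 &
    X' * u = u * X /\ Y' * u = u * Y].
Proof.
move=> tp; have [u [w [Fu Fw uw wu X'u]]] := half_intertwiner tp.
have [v [z [Fv Fz vz zv Y'v]]] : exists v z : R,
    [/\ F (v - 1), F (z - 1), z * v = 1, v * z = 1 & v * Y' = Y * v].
  exact: half_intertwiner (toeplitz_pair_conv tp).
have YcX : Y * (v * u) * X = v * u.
  by rewrite mulrA -Y'v -!mulrA -X'u [Y' * _]mulrA (tpYX' tp) mul1r.
have Fc : F (v * u - 1).
  have -> : v * u - 1 = (v - 1) * u + (u - 1) by rewrite mulrBl mul1r addrA subrK.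
  apply: (tpFD tp) => //; rewrite -[u](subrK 1) mulrDr mulr1.
  by apply: (tpFD tp) => //; apply: (tpFMr tp) => //; apply: (tpFG tp).
have YcX1 : Y * (v * u - 1) * X = v * u - 1.
  by rewrite mulrBr mulr1 mulrBl YcX (tpYX tp).
(* Iterating Y (c - 1) X = c - 1 is enough: c - 1 lies in F and is killed by a high power of X. *)
have cE k : Y ^+ k * (v * u - 1) * X ^+ k = v * u - 1.
  elim: k => [|k IH]; first by rewrite mul1r mulr1.
  rewrite exprSr exprS -{2}IH -{2}YcX1.
  by rewrite !mulrA.
have [N /(_ N (leqnn N)) [cX _ _ _]] := tp_kill tp Fc.
have vu : v * u = 1.
  by apply/eqP; rewrite -subr_eq0 -(cE N) -mulrA cX mulr0.
have vw : v = w by rewrite -[v]mulr1 -uw mulrA vu mul1r.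
exists u, w; split=> //; split=> //.
by rewrite -[LHS]mul1r -{1}uw -!mulrA [w * _]mulrA -vw Y'v -mulrA vu mulr1.
Qed.

(** * The subalgebras F(I) *)

Section Pieces.
Variables (K : fieldType) (n : nat) (A : unitAlgType K) (x y : 'I_n -> A).
Hypothesis hS : is_Sn x y.
Implicit Types (T I J : {set 'I_n}) (i j : 'I_n) (a b c : A).
Notation gen := (word_span x y).
Notation ei := (defect x y).
Notation inP := (torsion x).

(** Intrinsic form of F(I), from which stability under products is immediate. [inF_FI] identifies it
    with the span of matrix units; for empty I it consists of the scalars. *)
Definition finite_part I a : Prop := gen (~: I) a /\ forall i, i \in I -> inP i a.
Notation FI := finite_part.

Lemma FI0 I : FI I 0.
Proof. by split=> [|i _]; [apply: gen0|apply: inP0]. Qed.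
Lemma FID I a b : FI I a -> FI I b -> FI I (a + b).
Proof. by move=> [ga pa] [gb pb]; split=> [|i iI]; [apply: genD|apply: inPD; auto]. Qed.
Lemma FIN I a : FI I a -> FI I (- a).
Proof. by move=> [ga pa]; split=> [|i iI]; [apply: genN|apply: inPN; auto]. Qed.
Lemma FIB I a b : FI I a -> FI I b -> FI I (a - b).
Proof. by move=> Fa /FIN; apply: FID. Qed.
Lemma FIMl I a b : gen (~: I) a -> FI I b -> FI I (a * b).
Proof. by move=> ga [gb pb]; split=> [|i iI]; [apply: genM|apply: inPMl; auto]. Qed.
Lemma FIMr I a b : FI I a -> gen (~: I) b -> FI I (a * b).
Proof. by move=> [ga pa] gb; split=> [|i iI]; [apply: genM|apply: (inPMr hS); auto]. Qed.
Lemma FIZ I k a : FI I a -> FI I (k *: a).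
Proof. by move=> Fa; rewrite -mulr_algl; apply: FIMl Fa; apply/genZ/gen1. Qed.
Lemma FI_sum I (S : Type) (r : seq S) (P : pred S) F :
  (forall k, P k -> FI I (F k)) -> FI I (\sum_(k <- r | P k) F k).
Proof. by move=> h; apply: big_ind => //; [apply: FI0|apply: FID]. Qed.
Lemma FIU I J a b : FI I a -> FI J b -> FI (I :|: J) (a * b).
Proof.
move=> [ga pa] [gb pb]; split=> [|i].
  by apply: genM; [apply: genS ga|apply: genS gb]; rewrite setCU ?subsetIl ?subsetIr.
by rewrite inE => /orP[iI|iJ]; [apply: (inPMr hS); auto|apply: inPMl; auto].
Qed.

Lemma EuE k l i : Eu x y k l i = x i ^+ k * ei i * y i ^+ l.
Proof. by rewrite /Eu /defect mulrBr mulr1 mulrBl [in y i ^+ l.+1]exprS exprSr !mulrA. Qed.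

Lemma gen_Eu T k l i : i \notin T -> gen T (Eu x y k l i).
Proof.
move=> iT; rewrite EuE; apply: genM; last exact/genX/gen_y.
by apply: genM; [apply/genX/gen_x|apply: gen_ei].
Qed.
Lemma inP_Eu k l i : inP i (Eu x y k l i).
Proof. by rewrite EuE; apply: (inPMr hS); apply: inPMl; apply: (inP_ei hS). Qed.

Definition eprods (s : seq 'I_n) (al be : 'I_n -> nat) : A :=
  \prod_(i <- s) Eu x y (al i) (be i) i.

Lemma Eprod_eprods I al be : Eprod x y I al be = eprods (enum I) al be.
Proof. by rewrite /Eprod -big_filter [index_enum _]unlock. Qed.

Lemma FI_eprods s I al be : (forall i, (i \in s) = (i \in I)) -> FI I (eprods s al be).
Proof.
move=> sI; split=> [|i]; last rewrite -sI; last first.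
  elim: s {sI} => //= j s IH; rewrite inE /eprods big_cons => /orP[/eqP->|/IH ?].
    by apply: (inPMr hS); apply: inP_Eu.
  exact: inPMl.
rewrite /eprods big_seq; apply: big_ind => [||i]; [exact: gen1|exact: genM|].
by rewrite sI => iI; apply: gen_Eu; rewrite inE negbK.
Qed.

Inductive spanned (s : seq 'I_n) : A -> Prop :=
| spanned0 : spanned s 0
| spannedZ k al be a : spanned s a -> spanned s (k *: eprods s al be + a).

Lemma spannedD s a b : spanned s a -> spanned s b -> spanned s (a + b).
Proof.
move=> sa sb; elim: sa => [|k al be c _ IH]; first by rewrite add0r.
by rewrite -addrA; apply: spannedZ.
Qed.

Lemma spanned_Eu s i k l a : i \notin s -> spanned s a ->
  spanned (i :: s) (Eu x y k l i * a).
Proof.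
move=> is_; elim=> [|t al be c _ IH]; first by rewrite mulr0; apply: spanned0.
rewrite mulrDr -scalerAr.
pose ext (f : 'I_n -> nat) m := fun j => if j == i then m else f j.
have -> : Eu x y k l i * eprods s al be = eprods (i :: s) (ext al k) (ext be l).
  rewrite /eprods big_cons /ext eqxx; congr (_ * _).
  apply: eq_big_seq => j js; case: eqVneq => // ji.
  by rewrite ji (negbTE is_) in js.
exact: spannedZ.
Qed.

(** Expanding in one variable i gives matrix units E_km(i) times coefficients free of i. These stay
    torsion in the remaining variables, so induction applies to them. *)
Lemma killed_spanned s T a : uniq s -> (forall i, (i \in s) = (i \notin T)) ->
  gen T a -> (forall i, i \in s -> inP i a) -> spanned s a.
Proof.
elim: s T a => [|i s IH] T a /=.
  move=> _ sT ga _.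
  have TT : T = setT by apply/setP => i; rewrite inE; have := sT i; case: (i \in T).
  have [k ->] : exists k : K, a = k%:A by apply: (@gen_setT K n A x y); rewrite -TT.
  have := spannedZ k (fun=> 0) (fun=> 0) (spanned0 [::]).
  by rewrite addr0 /eprods big_nil.
move=> /andP[is_ us] sT ga pa.
have iT : i \notin T by rewrite -sT mem_head.
have iU : i \in i |: T by rewrite setU11.
have [N aN] := pa i (mem_head _ _).
rewrite (expand_killed y aN).
apply: big_ind => [||m _]; [exact: spanned0|exact: spannedD|].
have gax : gen T (a * x i ^+ m) by apply: genM => //; apply/genX/gen_x.
have [_ [p [gp ap]]] := gen_poly hS iT gax.
rewrite ap horner_coef !mulr_suml.
apply: big_ind => [||k _]; [exact: spanned0|exact: spannedD|].
have -> : p`_k * x i ^+ k * ei i * y i ^+ m = Eu x y k m i * p`_k.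
  rewrite EuE; suff <- : p`_k * (x i ^+ k * ei i * y i ^+ m) = x i ^+ k * ei i * y i ^+ m * p`_k.
    by rewrite !mulrA.
  apply: commrM; first apply: commrM.
  - by apply/commrX/(gen_commx hS iU).
  - exact: (gen_comm_ei hS iU).
  - by apply/commrX/(gen_commy hS iU).
apply: spanned_Eu => //; apply: (IH (i |: T)) => //.
  move=> j; rewrite in_setU1 negb_or -sT inE.
  by case: eqVneq => // ->; apply/negbTE.
move=> j js.
(* Up to the factor e_i the coefficient is a two-sided multiple of a, hence in P_j; [ei_inj] then
   removes e_i. *)
have [L eL] : inP j (p`_k * ei i).
  rewrite -(coef_extract hS k iU gp) -mulrA -ap mulrA.
  apply: (inPMr hS); apply: inPMl; apply: (inPMr hS).
  by apply: pa; rewrite inE js orbT.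
have ji : j != i by apply: contraNneq is_ => <-.
have jT : j \notin i |: T by rewrite in_setU1 negb_or ji -sT inE js orbT.
exists L; apply: (ei_inj hS iU); first by apply: genM => //; apply/genX/gen_x.
have -> : p`_k * x j ^+ L * ei i = p`_k * ei i * x j ^+ L; last by [].
by rewrite -!mulrA (gen_comm_ei hS iU (genX L (gen_x x y jT))).
Qed.

Lemma inF_FI I a : inF x y I a <-> FI I a.
Proof.
split=> [[s ->]|[ga pa]].
  apply: FI_sum => t _; apply: FIZ; rewrite Eprod_eprods.
  by apply: FI_eprods => i; rewrite mem_enum.
have : spanned (enum I) a.
  apply: (killed_spanned (enum_uniq I)) ga _ => i; rewrite mem_enum ?inE ?negbK //.
  exact: pa.
elim=> [|k al be b _ [s ->]]; first by exists [::]; rewrite big_nil.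
by exists ((k, (al, be)) :: s); rewrite big_cons /= Eprod_eprods.
Qed.

(** * Sums of the pieces F(I) and of the ideals P_t *)

Inductive finite_sum (R : pred {set 'I_n}) : A -> Prop :=
| FS0 : finite_sum R 0
| FS_add I a b : R I -> FI I a -> finite_sum R b -> finite_sum R (a + b).
Notation FS := finite_sum.

Implicit Types (R S : pred {set 'I_n}).

Lemma FS_FI R I a : R I -> FI I a -> FS R a.
Proof. by move=> RI Fa; rewrite -[a]addr0; apply: FS_add RI Fa (FS0 R). Qed.
Lemma FSD R a b : FS R a -> FS R b -> FS R (a + b).
Proof.
move=> Fa Fb; elim: Fa => [|I c d RI Fc _ IH]; first by rewrite add0r.
by rewrite -addrA; apply: FS_add RI Fc IH.
Qed.
Lemma FSN R a : FS R a -> FS R (- a).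
Proof.
elim=> [|I c d RI Fc _ IH]; first by rewrite oppr0; apply: FS0.
by rewrite opprD; apply: FS_add RI (FIN Fc) IH.
Qed.
Lemma FSB R a b : FS R a -> FS R b -> FS R (a - b).
Proof. by move=> Fa /FSN; apply: FSD. Qed.
Lemma FS_sub R S a : (forall I, R I -> S I) -> FS R a -> FS S a.
Proof. by move=> RS; elim=> [|I c d /RS RI Fc _ IH]; [apply: FS0|apply: FS_add RI Fc IH]. Qed.
(** Rests on F(I) F(J) lying in F(I union J); the family [U] records which unions occur. *)
Lemma FSM R S (U : pred {set 'I_n}) a b :
  (forall I J, R I -> S J -> U (I :|: J)) -> FS R a -> FS S b -> FS U (a * b).
Proof.
move=> RSU Fa Fb; elim: Fa => [|I c d RI Fc _ IH]; first by rewrite mul0r; apply: FS0.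
rewrite mulrDl; apply: FSD => {IH} //.
elim: Fb => [|J f g SJ Ff _ IH]; first by rewrite mulr0; apply: FS0.
rewrite mulrDr; apply: FSD => //.
by apply: (FS_FI (I := I :|: J)); [apply: RSU|apply: FIU].
Qed.
Lemma FS_sum R (f : {set 'I_n} -> A) : (forall I, R I -> FI I (f I)) ->
  FS R (\sum_(I | R I) f I).
Proof.
move=> Ff; apply: big_ind => [||I RI]; [exact: FS0|exact: FSD|].
by apply: (FS_FI RI); apply: Ff.
Qed.
Lemma FSP R a : FS R a ->
  exists f : {set 'I_n} -> A, (forall I, FI I (f I)) /\ a = \sum_(I | R I) f I.
Proof.
elim=> [|I b c RI Fb _ [f [Ff ->]]].
  by exists (fun=> 0); split=> [I|]; [apply: FI0|rewrite big1].
exists (fun J => if J == I then b + f J else f J); split=> [J|].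
  by case: eqP => [->|_] //; apply: FID.
rewrite (bigD1 I) //= [in RHS](bigD1 I) //= eqxx addrA; congr (_ + _).
by apply: eq_bigr => J /andP[_ /negbTE ->].
Qed.
Lemma FS_split R (P : pred {set 'I_n}) a : FS R a ->
  exists b c, [/\ a = b + c, FS (fun I => R I && P I) b & FS (fun I => R I && ~~ P I) c].
Proof.
elim=> [|I d f RI Fd _ [b [c [-> Fb Fc]]]].
  by exists 0, 0; rewrite addr0; split=> //; apply: FS0.
case PI : (P I).
  exists (d + b), c; rewrite addrA; split=> //.
  by apply: (@FS_add _ I) => //; rewrite RI.
exists b, (d + c); rewrite addrCA; split=> //.
by apply: (@FS_add _ I) => //; rewrite RI PI.
Qed.

Inductive torsion_sum T : A -> Prop :=
| JT0 : torsion_sum T 0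
| JT_add i a b : i \in T -> inP i a -> torsion_sum T b -> torsion_sum T (a + b).
Notation JT := torsion_sum.

Lemma JT_inP T i a : i \in T -> inP i a -> JT T a.
Proof. by move=> iT Pa; rewrite -[a]addr0; apply: JT_add iT Pa (JT0 T). Qed.
Lemma JTD T a b : JT T a -> JT T b -> JT T (a + b).
Proof.
move=> ja jb; elim: ja => [|i c d iT Pc _ IH]; first by rewrite add0r.
by rewrite -addrA; apply: JT_add iT Pc IH.
Qed.
Lemma JTMl T a b : JT T b -> JT T (a * b).
Proof.
elim=> [|i c d iT Pc _ IH]; first by rewrite mulr0; apply: JT0.
by rewrite mulrDr; apply: JT_add iT (inPMl _ Pc) IH.
Qed.
Lemma JTMr T a b : JT T a -> JT T (a * b).
Proof.
elim=> [|i c d iT Pc _ IH]; first by rewrite mul0r; apply: JT0.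
by rewrite mulrDl; apply: JT_add iT (inPMr hS b Pc) IH.
Qed.
Lemma JTN T a : JT T a -> JT T (- a).
Proof. by rewrite -mulN1r; apply: JTMl. Qed.
Lemma FS_JT R T a : (forall I, R I -> exists2 i, i \in I & i \in T) -> FS R a -> JT T a.
Proof.
move=> RT; elim=> [|I b c /RT [i iI iT] [_ Pb] _ IH]; first exact: JT0.
exact: JT_add iT (Pb i iI) IH.
Qed.

(* Every element of sum_{t in T} P_t is killed on the right by a high power of
   prod_{t in T} x_t, which is left cancellable. *)
Lemma JT_comm_eq0 T a : JT T a -> (forall t, t \in T -> GRing.comm a (x t)) -> a = 0.
Proof.
move=> ja ca.
pose xN N := \prod_(i <- enum T) x i ^+ N.
have [N aN] : exists N, forall M, (N <= M)%N -> a * xN M = 0.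
  elim: ja => [|i b c iT [N bN] _ [L IH]]; first by exists 0 => M _; rewrite mul0r.
  exists (N + L)%N => M NM; rewrite mulrDl IH ?(leq_trans (leq_addl _ _) NM) // addr0.
  have bM := inP_leq (leq_trans (leq_addr _ _) NM) bN.
  rewrite /xN; have: i \in enum T by rewrite mem_enum.
  elim: (enum T) b bM {bN IH xN} => //= j s IH b bM; rewrite inE big_cons mulrA.
  have [<-|ij] := eqVneq i j; first by rewrite bM mul0r.
  move=> /= /IH; apply; rewrite -mulrA.
  have /commrX -> : GRing.comm (x j ^+ M) (x i).
    by apply/commr_sym/commrX; apply: (xxC hS).
  by rewrite mulrA bM mul0r.
have : xN N * a = 0.
  rewrite -(aN N (leqnn N)); apply/commr_sym; rewrite /xN big_seq.
  apply: big_ind => [||i]; [exact: commr1|by move=> *; apply: commrM|].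
  by rewrite mem_enum => iT; apply/commrX/ca.
rewrite /xN; elim: (enum T) {xN aN} => [|i s IH]; first by rewrite big_nil mul1r.
rewrite big_cons -mulrA => /(congr1 (fun z => y i ^+ N * z)).
by rewrite mulr0 mulrA (yXxX hS) mul1r.
Qed.

Lemma JT_gen_eq0 T a : JT T a -> gen T a -> a = 0.
Proof. by move=> ja ga; apply: JT_comm_eq0 ja _ => t tT; apply: (gen_commx hS tT). Qed.

Definition torsion_cong T a b := JT T (a - b).
Notation congJ := torsion_cong.
Lemma congJ_refl T a : congJ T a a.
Proof. by rewrite /congJ subrr; apply: JT0. Qed.
Lemma congJM T a b c d : congJ T a b -> congJ T c d -> congJ T (a * c) (b * d).
Proof.
move=> ab cd; rewrite /congJ.
have -> : a * c - b * d = (a - b) * c + b * (c - d).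
  by rewrite mulrBl mulrBr addrA subrK.
by apply: JTD; [apply: JTMr|apply: JTMl].
Qed.
Lemma congJX T a b k : congJ T a b -> congJ T (a ^+ k) (b ^+ k).
Proof.
by move=> ab; elim: k => [|k IH]; rewrite ?exprS; [apply: congJ_refl|apply: congJM].
Qed.
Lemma congJ_sym T a b : congJ T a b -> congJ T b a.
Proof. by rewrite /congJ => /JTN; rewrite opprB. Qed.
(** Elements free of the indices in T meet the sum of the P_t, t in T, only in 0. An identity a' =
    b' thus descends to such elements congruent to a' and b'. *)
Lemma congJ_gen_eq T a b a' b' : congJ T a a' -> congJ T b b' -> a' = b' ->
  gen T a -> gen T b -> a = b.
Proof.
move=> aa' bb' ab ga gb; apply/eqP; rewrite -subr_eq0; apply/eqP.
apply: JT_gen_eq0 (genB ga gb).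
have -> : a - b = (a - a') + - (b - b') by rewrite ab opprB addrC addrA subrK addrC.
by apply: JTD => //; apply: JTN.
Qed.
End Pieces.

(** * Conjugating a perturbation by one F(I) *)

Lemma fin_eventually (T : finType) (P : T -> nat -> Prop) :
  (forall k, exists N, forall M, (N <= M)%N -> P k M) ->
  exists N, forall M, (N <= M)%N -> forall k, P k M.
Proof.
move=> h; suff [N hN] : exists N, forall M, (N <= M)%N -> forall k, k \in enum T -> P k M.
  by exists N => M NM k; apply: hN; rewrite ?mem_enum.
elim: (enum T) => [|t s [N hN]]; first by exists 0.
have [L hL] := h t; exists (L + N)%N => M NM k; rewrite inE => /orP[/eqP->|ks].
  by apply/hL/(leq_trans (leq_addr _ _) NM).
by apply: hN ks; apply: leq_trans (leq_addl _ _) NM.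
Qed.

Lemma eq_mul_expl (R : nzRingType) (a b p : R) m :
  a * p = b * p -> GRing.comm b p -> a ^+ m * p = b ^+ m * p.
Proof.
move=> ab bp; elim: m => [|m IH] //.
by rewrite exprSr -mulrA ab bp mulrA IH -mulrA -bp mulrA -exprSr.
Qed.
Lemma eq_mul_expr (R : nzRingType) (a b p : R) m :
  p * a = p * b -> GRing.comm b p -> p * a ^+ m = p * b ^+ m.
Proof.
move=> ab bp; elim: m => [|m IH] //.
by rewrite exprS mulrA ab -bp -mulrA IH mulrA bp -mulrA -exprS.
Qed.

(** * F({j}) as a union of matrix algebras over K *)

Section Matrices.
Variables (K : fieldType) (n : nat) (A : unitAlgType K) (x y : 'I_n -> A).
Hypothesis hS : is_Sn x y.
Variable j : 'I_n.
Notation ej := (defect x y j).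
Notation FI := (finite_part x y).
Notation E k l := (Eu x y k l j).

Let ej_neq0 : ej != 0.
Proof. by have := eprod_neq0 hS (s := [:: j]) isT; rewrite /defect_prod big_seq1. Qed.

Lemma Eu_mul k l p q : E k l * E p q = (l == p)%:R * E k q.
Proof.
rewrite !EuE.
have -> : x j ^+ k * ej * y j ^+ l * (x j ^+ p * ej * y j ^+ q) =
   x j ^+ k * (ej * y j ^+ l * x j ^+ p * ej) * y j ^+ q by rewrite !mulrA.
rewrite (ei_y_x_ei hS); case: eqP => _; rewrite ?mul1r ?mul0r ?mulr0 ?mul0r //.
Qed.

Lemma Eu_entry k l p q : ej * y j ^+ p * E k l * x j ^+ q * ej = ((p == k) && (l == q))%:R * ej.
Proof.
have -> : ej * y j ^+ p * E k l * x j ^+ q * ej = E 0 p * E k l * E q 0.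
  by rewrite !EuE !mulr1 !mul1r !mulrA.
have e00 : E 0 0 = ej by rewrite EuE mulr1 mul1r.
rewrite Eu_mul; case: eqP => _ /=; rewrite ?mul0r // mul1r Eu_mul e00.
by case: eqP.
Qed.

Definition mx_emb L (M : 'M[K]_L) : A := \sum_k \sum_l M k l *: E k l.

Lemma mx_embD L (M N : 'M[K]_L) : mx_emb (M + N) = mx_emb M + mx_emb N.
Proof.
rewrite /mx_emb -big_split; apply: eq_bigr => k _; rewrite -big_split.
by apply: eq_bigr => l _; rewrite mxE scalerDl.
Qed.
Lemma mx_embM L (M N : 'M[K]_L) : mx_emb (M *m N) = mx_emb M * mx_emb N.
Proof.
rewrite /mx_emb mulr_suml; apply: eq_bigr => k _; rewrite mulr_suml.
under [RHS]eq_bigr => l _.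
  rewrite mulr_sumr (bigD1 l) //= [X in _ + X]big1 => [|p pl].
    rewrite addr0 mulr_sumr.
    under eq_bigr => q _ do
      rewrite -scalerAl -scalerAr Eu_mul eqxx mul1r scalerA.
    over.
  rewrite mulr_sumr big1 // => q _.
  rewrite -scalerAl -scalerAr Eu_mul (_ : (l == p :> nat) = false) ?mul0r ?scaler0 //.
  by apply/negbTE; rewrite eq_sym.
rewrite exchange_big; apply: eq_bigr => q _ /=.
by rewrite mxE scaler_suml.
Qed.

Lemma mx_emb_entry L (M : 'M[K]_L) (p q : 'I_L) :
  ej * y j ^+ p * mx_emb M * x j ^+ q * ej = M p q *: ej.
Proof.
rewrite /mx_emb mulr_sumr !mulr_suml (bigD1 p) //= [X in _ + X]big1 => [|k kp].
  rewrite addr0 mulr_sumr !mulr_suml (bigD1 q) //= [X in _ + X]big1 => [|l lq].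
    by rewrite addr0 -scalerAr -!scalerAl Eu_entry !eqxx mul1r.
  rewrite -scalerAr -!scalerAl Eu_entry eqxx /= (_ : (l == q :> nat) = false) ?mul0r ?scaler0 //.
  exact/negbTE.
rewrite mulr_sumr !mulr_suml big1 // => l _.
rewrite -scalerAr -!scalerAl Eu_entry (_ : (p == k :> nat) = false) ?mul0r ?scaler0 //.
by apply/negbTE; rewrite eq_sym.
Qed.

Lemma mx_emb_eq0 L (M : 'M[K]_L) : mx_emb M = 0 -> M = 0.
Proof.
move=> M0; apply/matrixP => p q; rewrite mxE.
have := mx_emb_entry M p q; rewrite M0 mulr0 !mul0r => /esym/eqP.
by rewrite scaler_eq0 (negbTE ej_neq0) orbF => /eqP.
Qed.

Lemma FI_mx h : FI [set j] h ->
  exists L0, forall L, (L0 <= L)%N -> exists M : 'M[K]_L, h = mx_emb M.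
Proof.
move=> /(inF_FI hS)[s ->]; elim: s => [|t s [L0 IH]].
  by exists 0 => L _; exists 0; rewrite big_nil /mx_emb big1 // => k _;
    rewrite big1 // => l _; rewrite mxE scale0r.
exists (L0 + (t.2.1 j).+1 + (t.2.2 j).+1)%N => L hL.
have [|M hM] := IH L; first by lia.
have kL : (t.2.1 j < L)%N by lia.
have lL : (t.2.2 j < L)%N by lia.
exists (t.1 *: delta_mx (Ordinal kL) (Ordinal lL) + M).
rewrite big_cons mx_embD hM; congr (_ + _).
rewrite /Eprod big_set1 /mx_emb (bigD1 (Ordinal kL)) //= [X in _ = _ + X]big1 => [|k /negbTE kk].
  rewrite addr0 (bigD1 (Ordinal lL)) //= [X in _ = _ + X]big1 => [|l /negbTE ll].
    by rewrite addr0 !mxE !eqxx mulr1.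
  by rewrite !mxE ll andbF mulr0 scale0r.
by rewrite big1 // => l _; rewrite !mxE kk mulr0 scale0r.
Qed.

(** Both elements fit in matrices of one size, where a one-sided inverse is two-sided; [mx_emb] is
    injective and multiplicative, so relations transfer both ways. *)
Lemma FI_dedekind a b : FI [set j] a -> FI [set j] b ->
  (1 + a) * (1 + b) = 1 -> (1 + b) * (1 + a) = 1.
Proof.
move=> /FI_mx[La ha] /FI_mx[Lb hb].
have [M ->] := ha _ (leq_addr Lb La); have [N ->] := hb _ (leq_addl La Lb).
have exp_emb (P Q : 'M[K]_(La + Lb)) :
    (1 + mx_emb P) * (1 + mx_emb Q) = 1 + mx_emb (P + Q + P *m Q).
  by rewrite mulrDl mul1r mulrDr mulr1 !mx_embD mx_embM -!addrA [mx_emb Q + _]addrCA.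
have exp_mx (P Q : 'M[K]_(La + Lb)) :
    (1%:M + P) *m (1%:M + Q) = 1%:M + (P + Q + P *m Q).
  by rewrite mulmxDl mul1mx mulmxDr mulmx1 -!addrA [Q + _]addrCA.
rewrite !exp_emb => MN.
have {}MN : M + N + M *m N = 0 by apply: mx_emb_eq0; apply: (addrI 1); rewrite MN addr0.
have := exp_mx M N; rewrite MN addr0 => /mulmx1C; rewrite exp_mx.
rewrite -[in RHS](addr0 1%:M) => /addrI ->.
have := mx_embD (0 : 'M[K]_(La + Lb)) 0; rewrite addr0 => /esym/eqP.
by rewrite -subr_eq0 addrK => /eqP ->; rewrite addr0.
Qed.

Lemma FI_entry h : FI [set j] h -> h != 0 -> exists k l c,
  c != 0 /\ ej * y j ^+ k * h * x j ^+ l * ej = c *: ej.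
Proof.
move=> /FI_mx[L /(_ L (leqnn L)) [M hM]] h0.
have [k [l kl]] : exists k l, M k l != 0.
  apply: contrapT => nM; case/eqP: h0; rewrite hM /mx_emb big1 // => k _.
  rewrite big1 // => l _; suff -> : M k l = 0 by rewrite scale0r.
  by apply/eqP; apply: contraT => Mkl; case: nM; exists k, l.
by exists k, l, (M k l); rewrite hM mx_emb_entry.
Qed.

(** From h x_j = 0 follows h = h e_j: only column 0 is nonzero. A nonzero entry, necessarily in that
    column, is isolated by e_j y_j^k and normalised. *)
Lemma FI_right h : FI [set j] h -> h != 0 -> h * x j = 0 -> exists b, b * h = ej.
Proof.
move=> Fh h0 hx; have [k [l [c [c0 hc]]]] := FI_entry Fh h0.
exists (c^-1 *: (ej * y j ^+ k)); rewrite -scalerAl.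
have he : h = h * ej by rewrite mulrBr mulr1 mulrA hx mul0r subr0.
case: l hc => [|l]; first by rewrite mulr1 -mulrA -he => ->; rewrite scalerA mulVf // scale1r.
rewrite -[_ * h * _]mulrA exprS [h * _]mulrA hx mul0r mulr0 mul0r => /esym/eqP.
by rewrite scaler_eq0 (negbTE c0) (negbTE ej_neq0).
Qed.
Lemma FI_left h : FI [set j] h -> h != 0 -> y j * h = 0 -> exists b, h * b = ej.
Proof.
move=> Fh h0 yh; have [k [l [c [c0 hc]]]] := FI_entry Fh h0.
exists (c^-1 *: (x j ^+ l * ej)); rewrite -scalerAr mulrA.
have he : ej * h = h by rewrite mulrBl mul1r -mulrA yh mulr0 subr0.
case: k hc => [|k]; first by rewrite mulr1 he => ->; rewrite scalerA mulVf // scale1r.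
rewrite exprSr mulrA -[_ * y j * h]mulrA yh mulr0 !mul0r => /esym/eqP.
by rewrite scaler_eq0 (negbTE c0) (negbTE ej_neq0).
Qed.
End Matrices.

(** * The intertwiner attached to one set I *)

Section Local.
Variables (K : fieldType) (n : nat) (A : unitAlgType K) (x y : 'I_n -> A).
Hypothesis hS : is_Sn x y.
Variables (I : {set 'I_n}) (x' y' : 'I_n -> A).
Notation gen := (word_span x y).
Notation FI := (finite_part x y).
Hypothesis Fx : forall i, FI I (x' i - x i).
Hypothesis Fy : forall i, FI I (y' i - y i).
Hypothesis y'x' : forall i, i \in I -> y' i * x' i = 1.
Hypothesis comm' : forall i j, i \in I -> j \in I -> i != j ->
  [/\ x' i * y' j = y' j * x' i, x' i * x' j = x' j * x' i & y' i * y' j = y' j * y' i].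
Hypothesis kill' : forall h j, FI I h -> j \in I ->
  exists N, forall M, (N <= M)%N -> h * x' j ^+ M = 0 /\ y' j ^+ M * h = 0.

Let gI i : i \in I -> i \notin ~: I. Proof. by rewrite inE negbK. Qed.
Let gx' i : i \in I -> gen (~: I) (x' i).
Proof.
move=> iI; rewrite -[x' i](subrK (x i)); apply: genD; first by case: (Fx i).
by apply: gen_x; apply: gI.
Qed.
Let gy' i : i \in I -> gen (~: I) (y' i).
Proof.
move=> iI; rewrite -[y' i](subrK (y i)); apply: genD; first by case: (Fy i).
by apply: gen_y; apply: gI.
Qed.

Lemma kill_all h j : FI I h -> j \in I -> exists N, forall M, (N <= M)%N ->
  [/\ h * x j ^+ M = 0, y j ^+ M * h = 0, h * x' j ^+ M = 0 & y' j ^+ M * h = 0].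
Proof.
move=> Fh jI; have [N1 h1] := kill' Fh jI.
have [_ /(_ j jI) Ph] := Fh; have [N2 h2] := inP_killl hS Ph.
have [N3 h3] := Ph; exists (N1 + N2 + N3)%N => M NM.
have [|? ?] := h1 M; first by lia.
split=> //; last by apply: h2; lia.
by apply: inP_leq h3; lia.
Qed.

Lemma FI_expB a b k : gen (~: I) a -> gen (~: I) b -> FI I (a - b) -> FI I (a ^+ k - b ^+ k).
Proof.
move=> ga gb Fab; elim: k => [|k IH]; first by rewrite subrr; apply: FI0.
rewrite !exprS (_ : _ - _ = (a - b) * a ^+ k + b * (a ^+ k - b ^+ k)).
  by apply: FID; [apply: (FIMr hS) => //; apply: genX|apply: FIMl].
by rewrite mulrBl mulrBr addrA subrK.
Qed.

Lemma local_conj1 j : I = [set j] -> exists u w,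
  [/\ FI I (u - 1), FI I (w - 1), u * w = 1, w * u = 1 &
      forall i, i \in I -> x' i * u = u * x i /\ y' i * u = u * y i].
Proof.
move=> Ij; have jI : j \in I by rewrite Ij set11.
have gX : gen (~: I) (x j) by apply: gen_x; apply: gI.
have gY : gen (~: I) (y j) by apply: gen_y; apply: gI.
have tp : toeplitz_pair (gen (~: I)) (FI I) (x j) (y j) (x' j) (y' j).
  split=> //; do ?by [apply: (yx hS)|apply: y'x'|apply: gx'|apply: gy'].
  - exact: gen1.
  - exact: genM.
  - by move=> a [].
  - exact: FID.
  - exact: FIN.
  - exact: FIMl.
  - exact: FIMr.
  - split; first by apply: gen_ei; apply: gI.
    by rewrite Ij => i; rewrite inE => /eqP ->; apply: (inP_ei hS).
  - by move=> h Fh; apply: kill_all.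
  - by rewrite Ij; apply: (FI_dedekind hS).
  - by have := eprod_neq0 hS (s := [:: j]) isT; rewrite /defect_prod big_seq1.
  - by rewrite Ij; apply: (FI_right hS).
  - by rewrite Ij; apply: (FI_left hS).
have [u [w [Fu Fw uw wu xyu]]] := toeplitz_intertwiner tp.
by exists u, w; split=> // i; rewrite Ij inE => /eqP ->.
Qed.

(* For i <> j in I the elements y'_i^N x_i^N and y'_j^N x_j^N agree; the first
   intertwines x_k, y_k for every k <> i, the second for every k <> j. *)
Lemma local_conj2 i j : i \in I -> j \in I -> i != j -> exists u w,
  [/\ FI I (u - 1), FI I (w - 1), u * w = 1, w * u = 1 &
      forall i, i \in I -> x' i * u = u * x i /\ y' i * u = u * y i].
Proof.
move=> iI jI ij.
(* One N, uniform over the finitely many pairs of indices, beyond which primed letters act as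
   unprimed ones next to N-th powers with index in I. *)
have [N kN] : exists N, forall M, (N <= M)%N -> forall kt : 'I_n * 'I_n, kt.2 \in I ->
    [/\ x' kt.1 * x kt.2 ^+ M = x kt.1 * x kt.2 ^+ M,
        x' kt.1 * x' kt.2 ^+ M = x kt.1 * x' kt.2 ^+ M,
        y kt.2 ^+ M * x' kt.1 = y kt.2 ^+ M * x kt.1 &
        y' kt.2 ^+ M * x' kt.1 = y' kt.2 ^+ M * x kt.1] /\
    [/\ y' kt.1 * x kt.2 ^+ M = y kt.1 * x kt.2 ^+ M,
        y' kt.1 * x' kt.2 ^+ M = y kt.1 * x' kt.2 ^+ M,
        y kt.2 ^+ M * y' kt.1 = y kt.2 ^+ M * y kt.1 &
        y' kt.2 ^+ M * y' kt.1 = y' kt.2 ^+ M * y kt.1].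
  apply: fin_eventually => -[k t] /=.
  have [tI|tI] := boolP (t \in I); last by exists 0.
  have [N1 h1] := kill_all (Fx k) tI; have [N2 h2] := kill_all (Fy k) tI.
  exists (N1 + N2)%N => M NM _.
  have [a1 a2 a3 a4] := h1 M (leq_trans (leq_addr _ _) NM).
  have [b1 b2 b3 b4] := h2 M (leq_trans (leq_addl _ _) NM).
  by split; split; apply/eqP; rewrite -subr_eq0 -?mulrBl -?mulrBr; apply/eqP.
have {}kN k t := kN N (leqnn N) (k, t); simpl in kN.
have cx k l : GRing.comm (x k) (x l ^+ N) by apply/commrX/(xxC hS).
have cy k l : GRing.comm (y k) (y l ^+ N) by apply/commrX/(yyC hS).
have cx' k l : k \in I -> l \in I -> GRing.comm (x' k) (x' l ^+ N).
  move=> kI lI; apply: commrX; have [->//|kl] := eqVneq k l.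
  by case: (comm' kI lI kl).
have cy' k l : k \in I -> l \in I -> GRing.comm (y' k) (y' l ^+ N).
  move=> kI lI; apply: commrX; have [->//|kl] := eqVneq k l.
  by case: (comm' kI lI kl).
pose u t := y' t ^+ N * x t ^+ N; pose w t := y t ^+ N * x' t ^+ N.
have Fu t : t \in I -> FI I (u t - 1).
  move=> tI; rewrite -(yXxX hS t N) -mulrBl; apply: (FIMr hS).
    by apply: FI_expB => //; [apply: gy'|apply: gen_y; apply: gI].
  by apply/genX/gen_x/gI.
have Fw t : t \in I -> FI I (w t - 1).
  move=> tI; rewrite -(yXxX hS t N) -mulrBr; apply: FIMl.
    by apply/genX/gen_y/gI.
  by apply: FI_expB => //; [apply: gx'|apply: gen_x; apply: gI].
have y'x'N t : t \in I -> y' t ^+ N * x' t ^+ N = 1.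
  by move=> tI; apply: leftinvX; apply: y'x'.
(* Both sides equal y'_k^N y'_l^N x_l^N x_k^N, which is symmetric in k and l. *)
have uu k l : k \in I -> l \in I -> k != l -> u k = u l.
  move=> kI lI kl.
  have hu a b : a \in I -> b \in I -> y' a ^+ N * (y' b ^+ N * x b ^+ N) * x a ^+ N = u a.
    move=> aI bI; rewrite -!mulrA; congr (_ * _).
    have [[h _ _ _] _] := kN b a aI.
    by rewrite -(eq_mul_expl N h (cx b a)) mulrA y'x'N // mul1r.
  rewrite -(hu k l) // -(hu l k) // !mulrA.
  have -> : y' k ^+ N * y' l ^+ N = y' l ^+ N * y' k ^+ N.
    by apply/commr_sym/commrX/commr_sym; apply: cy'.
  rewrite -!mulrA; congr (_ * (_ * _)).
  by apply/commr_sym/commrX/commr_sym; apply: cx.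
have int k t : k \in I -> t \in I -> k != t -> x' k * u t = u t * x k /\ y' k * u t = u t * y k.
  move=> kI tI kt; have [[hx1 _ _ hx2] [hy1 _ _ hy2]] := kN k t tI.
  have xyk : GRing.comm (x' k) (y' t ^+ N) by apply: commrX; case: (comm' kI tI kt).
  have xtk : GRing.comm (y k) (x t ^+ N).
    by apply: commrX; rewrite /GRing.comm (xyC hS) // eq_sym.
  rewrite /u; split; rewrite mulrA.
    by rewrite xyk -mulrA hx1 cx mulrA.
  by rewrite cy' // -mulrA hy1 xtk mulrA.
have commN k t a b : k \in I -> t \in I -> k != t -> a \in [:: x' k; y' k] ->
    b \in [:: x' t; y' t] -> a ^+ N * b ^+ N = b ^+ N * a ^+ N.
  move=> kI tI kt; have [c1 c2 c3] := comm' kI tI kt.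
  have [|d1 _ _] := comm' tI kI; first by rewrite eq_sym.
  move=> ha hb; suff ab : GRing.comm a b by apply/commrX/commr_sym/commrX/commr_sym.
  by move: ha hb; rewrite !inE => /orP[]/eqP-> /orP[]/eqP->.
have ji : j != i by rewrite eq_sym.
(* The inverse is written with the other index j, so that the two inner powers commute and can be
   exchanged before cancelling. *)
exists (u i), (w j); split.
- exact: Fu.
- exact: Fw.
- have [_ [_ _ _ hA]] := kN j i iI; have [[_ hQ _ _] _] := kN i j jI.
  have AB := eq_mul_expr N (esym hA) (cy' j i jI iI).
  have PQ := eq_mul_expl N (esym hQ) (cx' i j iI jI).
  have PB : GRing.comm (x i ^+ N) (y j ^+ N).
    by apply/commrX/commr_sym/commrX; rewrite /GRing.comm (xyC hS).
  rewrite /u /w -mulrA [x i ^+ N * _]mulrA PB -mulrA PQ mulrA AB -mulrA.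
  have -> : y' j ^+ N * (x' i ^+ N * x' j ^+ N) = x' i ^+ N.
    by rewrite (commN i j) ?inE ?eqxx ?orbT // mulrA y'x'N // mul1r.
  by rewrite y'x'N.
- have [_ [_ _ hB _]] := kN i j jI; have [[hQ _ _ _] _] := kN j i iI.
  have AB := eq_mul_expr N hB (cy i j).
  have PQ := eq_mul_expl N hQ (cx j i).
  rewrite /u /w -mulrA [x' j ^+ N * _]mulrA (commN j i) ?inE ?eqxx ?orbT //.
  rewrite -mulrA PQ mulrA AB -mulrA.
  have -> : y i ^+ N * (x j ^+ N * x i ^+ N) = x j ^+ N.
    have -> : x j ^+ N * x i ^+ N = x i ^+ N * x j ^+ N.
      by apply/commr_sym/commrX/commr_sym; apply: cx.
    by rewrite mulrA (yXxX hS) mul1r.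
  by rewrite (yXxX hS).
- move=> k kI; have [ki|ki] := eqVneq k i; last exact: int.
  by rewrite (uu i j) // ki; apply: int.
Qed.

Lemma local_conj : I != set0 -> exists u w,
  [/\ FI I (u - 1), FI I (w - 1), u * w = 1, w * u = 1 &
      forall i, i \in I -> x' i * u = u * x i /\ y' i * u = u * y i].
Proof.
case/set0Pn => i iI; have [Ii|] := eqVneq I [set i]; first exact: (local_conj1 Ii).
move=> Ii; have [j jI ij] : exists2 j, j \in I & i != j.
  apply/exists_inP; apply: contraR Ii; rewrite negb_exists_in => /forall_inP h.
  apply/eqP/setP => j; rewrite inE; apply/idP/eqP => [/h|-> //].
  by rewrite negbK => /eqP.
exact: (local_conj2 iI jI ij).
Qed.
End Local.

(** * Factorisation *)

Section Final.
Variables (K : fieldType) (n : nat) (A : unitAlgType K) (x y : 'I_n -> A).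
Hypothesis hS : is_Sn x y.
Implicit Types (T I J : {set 'I_n}) (i j : 'I_n) (a b c : A) (s : A -> A).
Notation gen := (word_span x y).
Notation FI := (finite_part x y).
Notation FS := (finite_sum x y).
Notation inP := (torsion x).
Notation JT := (torsion_sum x).
Notation congJ := (torsion_cong x).
Notation nonempty := (fun I : {set 'I_n} => I != set0).

Lemma FS_gen (P : pred {set 'I_n}) T a :
  (forall I, P I -> T \subset ~: I) -> FS P a -> gen T a.
Proof.
move=> PT; elim=> [|I b c /PT TI [gb _] _ IH]; first exact: gen0.
by apply: genD => //; apply: genS gb.
Qed.
Lemma FS_inP (P : pred {set 'I_n}) i a : (forall I, P I -> i \in I) -> FS P a -> inP i a.
Proof.
move=> Pi; elim=> [|I b c /Pi iI [_ Pb] _ IH]; first exact: inP0.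
by apply: inPD => //; apply: Pb.
Qed.

(* Modulo the ideal of e_j the elements x_j, y_j become central and mutually
   inverse, so that the components of f, g with j not in I have degree 0 in x_j,
   whereas the relation forces y_j f + g x_j + g f = 0. *)
Lemma FS_support (P : pred {set 'I_n}) j f g :
  FS P f -> FS P g -> (y j + g) * (x j + f) = 1 ->
  FS (fun I => P I && (j \in I)) f /\ FS (fun I => P I && (j \in I)) g.
Proof.
move=> /(FS_split (fun I => j \in I))[f1 [f0 [-> Ff1 Ff0]]].
move=> /(FS_split (fun I => j \in I))[g1 [g0 [-> Fg1 Fg0]]] fg.
have sub I : P I && (j \notin I) -> [set j] \subset ~: I by move=> /andP[_ jI]; rewrite sub1set inE.
have gf := FS_gen sub Ff0; have gg := FS_gen sub Fg0.
have Jj P' b : FS (fun I => P' I && (j \in I)) b -> JT [set j] b.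
  by move=> Fb; apply: JT_inP (set11 j) _; apply: FS_inP Fb => I /andP[].
have jj := set11 j.
have fx := gen_commx hS jj gf; have gx := gen_commx hS jj gg.
(* [t] is y_j f0 + g0 x_j + g0 f0 multiplied on the right by x_j, which removes y_j. It commutes
   with x_j and lies in P_j, hence vanishes. *)
pose t := f0 + g0 * x j * x j + g0 * f0 * x j.
have t0 : t = 0.
  apply: (JT_comm_eq0 hS (T := [set j])) => [|k]; last first.
    rewrite inE => /eqP ->; apply/commr_sym; apply: commrD; first apply: commrD.
    - exact: commr_sym.
    - by do 2![apply: commrM; last exact: commr_refl]; apply: commr_sym.
    - by apply: commrM; last exact: commr_refl; apply: commrM; apply: commr_sym.
  have : congJ [set j] ((y j + (g1 + g0)) * (x j + (f1 + f0))) ((y j + g0) * (x j + f0)).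
    by apply: (congJM hS); rewrite /torsion_cong opprD addrACA subrr add0r addrK; apply: Jj; eassumption.
  rewrite fg => /(congJ_sym (T := [set j])); rewrite /torsion_cong => J1.
  have E : (y j + g0) * (x j + f0) - 1 = y j * f0 + (g0 * x j + g0 * f0).
    by rewrite mulrDl !mulrDr (yx hS) -[1 + _ + _]addrA [LHS]addrC addKr.
  have := JTMr hS (x j) J1; rewrite E !mulrDl -[y j * f0 * _]mulrA fx.
  by rewrite mulrA (yx hS) mul1r addrA.
have f00 : f0 = 0.
  apply: (gen_inj hS jj gf); have := congr1 (fun z => defect x y j * z) t0.
  have eg0 : defect x y j * (g0 * x j) = 0 by rewrite gx mulrA (ei_x hS) mul0r.
  have egf : defect x y j * (g0 * f0 * x j) = 0.
    by rewrite -mulrA fx [g0 * _]mulrA gx !mulrA (ei_x hS) !mul0r.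
  by rewrite /t !mulrDr [_ * (_ * x j * x j)]mulrA eg0 egf mul0r !addr0 mulr0.
have g00 : g0 = 0.
  move: t0; rewrite /t f00 mulr0 mul0r add0r addr0 gx -mulrA gx.
  move=> /(congr1 (fun z => y j * (y j * z))).
  by rewrite !mulr0 [y j * (x j * _)]mulrA (yx hS) mul1r mulrA (yx hS) mul1r.
by rewrite f00 g00 !addr0.
Qed.

Lemma conj_aut s u w : is_alg_aut s -> u * w = 1 -> w * u = 1 ->
  is_alg_aut (fun a => w * s a * u).
Proof.
move=> [[sl s1 sM] [r rK sK]] uw wu; split; [split|].
- by move=> k a b; rewrite sl mulrDr mulrDl -scalerAr -scalerAl.
- by rewrite s1 mulr1.
- by move=> a b; rewrite sM !mulrA -[_ * u * w]mulrA uw mulr1.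
- exists (fun a => r (u * a * w)) => a.
    by rewrite !mulrA uw mul1r -mulrA uw mulr1.
  by rewrite sK !mulrA wu mul1r -mulrA wu mulr1.
Qed.

Lemma FS_mul_near1 (P : pred {set 'I_n}) I a u :
  (forall J, P J -> P (I :|: J)) -> FI I (u - 1) -> FS P a ->
  FS P (u * a) /\ FS P (a * u).
Proof.
move=> PI Fu Fa; have Fu1 := FS_FI (R := pred1 I) (eqxx I) Fu.
rewrite -[u](subrK 1) mulrDl mulrDr mul1r mulr1; split; apply: FSD => //.
  by apply: (FSM hS) Fu1 Fa => J L /eqP ->; apply: PI.
by apply: (FSM hS) Fa Fu1 => J L PJ /eqP ->; rewrite setUC; apply: PI.
Qed.

Lemma split_head I0 (R : seq {set 'I_n}) i d :
  FS (fun I => (I \in I0 :: R) && (i \in I)) d ->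
  exists b, [/\ FI I0 b, i \notin I0 -> b = 0 & FS (mem R) (d - b)].
Proof.
elim=> [|I b c RI Fb _ [b' [Fb' b'0 Fc]]].
  by exists 0; split=> //; [apply: FI0|rewrite subr0; apply: FS0].
have [II|II] := eqVneq I I0.
  exists (b + b'); split.
  - by apply: FID => //; rewrite -II.
  - by move: RI => /andP[_]; rewrite II => ->.
  - by rewrite opprD addrACA subrr add0r.
exists b'; split=> //; rewrite -addrA; apply: FS_add Fb Fc.
by move: RI; rewrite inE (negbTE II) => /andP[].
Qed.

(** Every J in [R] has an element outside I0, so modulo the sum of the P_t with t outside I0 the
    images sigma(x_i), sigma(y_i) become x'_i, y'_i. The relations and the torsion property descend
    to these, and [local_conj] gives u. The remainder stays in [R], which is stable under union with
    I0. *)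
Lemma peel I0 (R : seq {set 'I_n}) s :
  I0 != set0 -> (forall J, J \in R -> ~~ (J \subset I0)) ->
  (forall J, J \in R -> I0 :|: J \in R) -> is_alg_aut s ->
  (forall i, FS (mem (I0 :: R)) (s (x i) - x i) /\ FS (mem (I0 :: R)) (s (y i) - y i)) ->
  exists u w, [/\ FI I0 (u - 1), FI I0 (w - 1), u * w = 1, w * u = 1 &
    forall i, FS (mem R) (w * s (x i) * u - x i) /\ FS (mem R) (w * s (y i) * u - y i)].
Proof.
move=> I00 RI0 RU s_aut Fs; have [s_mor _] := s_aut; have [_ s1 sM] := s_mor.
(* All components of the i-th differences contain i, so these lie in P_i, as [killed_by_image]
   requires. *)
have supp i : FS (fun I => (I \in I0 :: R) && (i \in I)) (s (x i) - x i) /\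
              FS (fun I => (I \in I0 :: R) && (i \in I)) (s (y i) - y i).
  have [Fx Fy] := Fs i; apply: FS_support Fx Fy _.
  by rewrite ![_ + (_ - _)]addrC !subrK -sM (yx hS).
have inPi i (P : pred {set 'I_n}) d : FS (fun I => P I && (i \in I)) d -> inP i d.
  by apply: FS_inP => I /andP[].
have killed := killed_by_image hS s_aut (fun i => inPi i _ _ (proj1 (supp i)))
   (fun i => inPi i _ _ (proj2 (supp i))).
have [bx hbx] := choice (fun i => split_head (proj1 (supp i))).
have [by_ hby] := choice (fun i => split_head (proj2 (supp i))).
pose x' i := x i + bx i; pose y' i := y i + by_ i.
pose T := ~: I0.
have RT I : I \in R -> exists2 i, i \in I & i \in T.
  by move=> /RI0/subsetPn[i iI iI0]; exists i; rewrite ?inE.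
have cx i : congJ T (x' i) (s (x i)).
  apply: congJ_sym; have [_ _ Fd] := hbx i.
  by rewrite /torsion_cong /x' opprD addrA; apply: FS_JT RT Fd.
have cy i : congJ T (y' i) (s (y i)).
  apply: congJ_sym; have [_ _ Fd] := hby i.
  by rewrite /torsion_cong /y' opprD addrA; apply: FS_JT RT Fd.
have gI i : i \in I0 -> i \notin T by rewrite inE negbK.
have gx i : i \in I0 -> gen T (x' i).
  by move=> iI; apply: genD; [apply/gen_x/gI|have [[]] := hbx i].
have gy i : i \in I0 -> gen T (y' i).
  by move=> iI; apply: genD; [apply/gen_y/gI|have [[]] := hby i].
have eqT := congJ_gen_eq hS (T := T).
have y'x' i : i \in I0 -> y' i * x' i = 1.
  move=> iI; apply: eqT (congJM hS (cy i) (cx i)) (congJ_refl _ _ 1) _ _ _.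
  - by rewrite -sM (yx hS).
  - by apply: genM; [apply: gy|apply: gx].
  - exact: gen1.
have comm' i j : i \in I0 -> j \in I0 -> i != j ->
  [/\ x' i * y' j = y' j * x' i, x' i * x' j = x' j * x' i & y' i * y' j = y' j * y' i].
  move=> iI jI ij; split.
  - apply: eqT (congJM hS (cx i) (cy j)) (congJM hS (cy j) (cx i)) _ _ _.
    + by rewrite -!sM (xyC hS).
    + by apply: genM; [apply: gx|apply: gy].
    + by apply: genM; [apply: gy|apply: gx].
  - apply: eqT (congJM hS (cx i) (cx j)) (congJM hS (cx j) (cx i)) _ _ _.
    + by rewrite -!sM (xxC hS).
    + by apply: genM; apply: gx.
    + by apply: genM; apply: gx.
  - apply: eqT (congJM hS (cy i) (cy j)) (congJM hS (cy j) (cy i)) _ _ _.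
    + by rewrite -!sM (yyC hS).
    + by apply: genM; apply: gy.
    + by apply: genM; apply: gy.
have kill' h j : FI I0 h -> j \in I0 ->
  exists N, forall M, (N <= M)%N -> h * x' j ^+ M = 0 /\ y' j ^+ M * h = 0.
  move=> [gh Ph] jI; have [N hN] := killed j h (Ph j jI).
  exists N => M /hN [h1 h2]; split.
    apply: eqT (congJM hS (congJ_refl _ _ h) (congJX hS M (cx j))) (congJ_refl _ _ 0) h1 _ _.
    + by apply: genM => //; apply/genX/gx.
    + exact: gen0.
  apply: eqT (congJM hS (congJX hS M (cy j)) (congJ_refl _ _ h)) (congJ_refl _ _ 0) h2 _ _.
  + by apply: genM => //; apply/genX/gy.
  + exact: gen0.
have Fx' i : FI I0 (x' i - x i) by rewrite /x' addrC addKr; case: (hbx i).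
have Fy' i : FI I0 (y' i - y i) by rewrite /y' addrC addKr; case: (hby i).
have [u [w [Fu Fw uw wu int]]] := local_conj hS Fx' Fy' y'x' comm' kill' I00.
exists u, w; split=> // i.
have [x'u y'u] : x' i * u = u * x i /\ y' i * u = u * y i.
  have [/int//|iI] := boolP (i \in I0).
  (* For i outside I0 there is no correction, and u, built from indices in I0, commutes with x_i and
     y_i. *)
  have [_ /(_ iI) bx0 _] := hbx i; have [_ /(_ iI) by0 _] := hby i.
  rewrite /x' /y' bx0 by0 !addr0.
  have gu : gen T u by rewrite -[u](subrK 1); apply: genD; [case: Fu|apply: gen1].
  have iT : i \in T by rewrite inE.
  by split; apply/esym; [apply: (gen_commx hS iT)|apply: (gen_commy hS iT)].
have [_ _ Fdx] := hbx i; have [_ _ Fdy] := hby i.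
have near P' z z' d : z' * u = u * z -> d - z' = P' -> FS (mem R) P' ->
    FS (mem R) (w * d * u - z).
  move=> zu dz Fd.
  have -> : w * d * u - z = w * (P' * u).
    by rewrite -dz mulrBl mulrBr zu !mulrA wu mul1r.
  by apply: (proj1 (FS_mul_near1 RU Fw _)); apply: (proj2 (FS_mul_near1 RU Fu _)).
split; [apply: near x'u _ Fdx|apply: near y'u _ Fdy].
  by rewrite /x' opprD addrA.
by rewrite /y' opprD addrA.
Qed.

Lemma unit_pair (u w : A) : u * w = 1 -> w * u = 1 -> u \is a GRing.unit /\ u^-1 = w.
Proof.
move=> uw wu; have uU : u \is a GRing.unit by apply/unitrP; exists w.
by split=> //; rewrite -[LHS]mulr1 -uw mulKr.
Qed.

Lemma unitMI_FI I (u : A) : unitMI x y I u <->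
  [/\ u \is a GRing.unit, FI I (u - 1) & FI I (u^-1 - 1)].
Proof.
have inMI_FI a : inMI x y I a <-> FI I (a - 1).
  split=> [[f [/(inF_FI hS) Ff ->]]|Fa]; first by rewrite addrC addKr.
  by exists (a - 1); split; [apply/(inF_FI hS)|rewrite addrC subrK].
by split=> -[uU /inMI_FI ? /inMI_FI ?]; split.
Qed.

Lemma inMn_FS a : inMn x y a <-> FS nonempty (a - 1).
Proof.
split=> [[f [Ff ->]]|/FSP[f [Ff fE]]].
  by rewrite addrC addKr; apply: FS_sum => I /Ff/(inF_FI hS).
by exists f; split=> [I _|]; [apply/(inF_FI hS)|rewrite -fE addrC subrK].
Qed.

(** The scalar summand counts as the component of the empty set; [aut_FS_nonempty] removes it
    later. *)
Lemma inFn_FS a : inFn x y a -> FS predT a.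
Proof.
move=> [c [f [Ff ->]]]; apply: FSD.
  apply: (FS_FI (I := set0)) => //; split=> [|i]; last by rewrite inE.
  exact/genZ/gen1.
apply: (FS_sub (R := nonempty)) => //.
by apply: FS_sum => I /Ff/(inF_FI hS).
Qed.
Lemma FS_inFn a : FS nonempty a -> inFn x y a.
Proof.
move=> /FSP[f [Ff ->]]; exists 0, f; split=> [I _|]; first exact/(inF_FI hS).
by rewrite scale0r add0r.
Qed.

Lemma eq_omega_prod (R : seq {set 'I_n}) (u v : {set 'I_n} -> A) :
  (forall I, I \in R -> u I = v I) -> omega_prod R u =1 omega_prod R v.
Proof.
elim: R => [|I R IH] //= uv a; rewrite uv ?mem_head // IH // => J JR.
by apply: uv; rewrite inE JR orbT.
Qed.

Lemma alg_morph_id s : alg_morph s -> (forall i, s (x i) = x i /\ s (y i) = y i) -> s =1 id.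
Proof.
move=> [sl s1 sM] sxy a; elim: (gen_all hS a) => //=.
- by move=> k b c _ sb _ sc; rewrite sl sb sc.
- by move=> i b _ _ sb; rewrite sM sb (proj1 (sxy i)).
- by move=> i b _ _ sb; rewrite sM sb (proj2 (sxy i)).
Qed.

(** * Peeling along an ordering by cardinality *)

Definition card_le I J := (#|I| <= #|J|)%N.

Definition upset (R : seq {set 'I_n}) : Prop :=
  forall J L : {set 'I_n}, J \in R -> J \subset L -> L \in R.

(** A later J has at least as many elements as I0, so J inside I0 would force J = I0, contrary to I0
    being absent from [R]. *)
Lemma upset_cons I0 (R : seq {set 'I_n}) :
  I0 \notin R -> path card_le I0 R -> upset (I0 :: R) ->
  (forall J, J \in R -> ~~ (J \subset I0)) /\ upset R.
Proof.
move=> I0R sR up.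
have RI0 J : J \in R -> ~~ (J \subset I0).
  move=> JR; have /allP/(_ J JR) := order_path_min (fun _ _ _ => @leq_trans _ _ _) sR.
  rewrite /card_le => cJ; apply: contra I0R => JI0.
  by have /eqP <- : J == I0 by rewrite eqEcard JI0.
split=> // J L JR JL.
have := up J L; rewrite !inE JR orbT => /(_ isT JL) /orP[/eqP LI|//].
by case/negP: (RI0 J JR); rewrite -LI.
Qed.

Lemma factorization (R : seq {set 'I_n}) s :
  uniq R -> sorted card_le R -> set0 \notin R ->
  upset R -> is_alg_aut s ->
  (forall i, FS (mem R) (s (x i) - x i) /\ FS (mem R) (s (y i) - y i)) ->
  exists u : {set 'I_n} -> A,
    (forall I, I \in R -> unitMI x y I (u I)) /\ s =1 omega_prod R u.
Proof.
elim: R s => [|I0 R IH] s.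
  move=> _ _ _ _ [s_mor _] Fs; exists (fun=> 1); split=> // a.
  apply: alg_morph_id => // i; have [Fx Fy] := Fs i.
  have FS_nil d : FS (mem [::]) d -> d = 0 by elim=> [|I b c].
  by split; apply/eqP; rewrite -subr_eq0; apply/eqP/FS_nil.
move=> /andP[I0R uR] sR; rewrite inE negb_or eq_sym => /andP[I00 R0] up s_aut Fs.
have [RI0 upR] := upset_cons I0R sR up.
have RU J : J \in R -> I0 :|: J \in R by move=> JR; apply: upR JR (subsetUr _ _).
have [u0 [w0 [Fu Fw uw wu Fs1]]] := peel I00 RI0 RU s_aut Fs.
have [u [uU sE]] := IH _ uR (path_sorted sR) R0 upR (conj_aut s_aut uw wu) Fs1.
have [u0U u0w] := unit_pair uw wu.
exists (fun I => if I == I0 then u0 else u I); split=> [I|a].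
  rewrite inE; case: eqP => [-> _|_ /= /uU //].
  by apply/unitMI_FI; rewrite u0w.
rewrite /= eqxx (@eq_omega_prod R _ u) => [|I IR]; last first.
  by case: eqP IR I0R => // -> ->.
by rewrite -sE /omega u0w !mulrA uw mul1r -mulrA uw mulr1.
Qed.

(** * Units of M_n and uniqueness *)

Lemma near1M (P : pred {set 'I_n}) (a b : A) :
  (forall I J, P I -> P J -> P (I :|: J)) ->
  FS P (a - 1) -> FS P (b - 1) -> FS P (a * b - 1).
Proof.
move=> PU Fa Fb.
have -> : a * b - 1 = (a - 1) * (b - 1) + (a - 1) + (b - 1).
  by rewrite mulrBr mulr1 subrK mulrBl mul1r addrA subrK.
by apply: FSD => //; apply: FSD => //; apply: (FSM hS) Fa Fb.
Qed.

Lemma nonemptyU I J : I != set0 -> J != set0 -> I :|: J != set0.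
Proof. by move=> I0 _; rewrite setU_eq0 negb_and I0. Qed.

Lemma prod_near1 (P : pred {set 'I_n}) (R : seq {set 'I_n}) (u : {set 'I_n} -> A) :
  (forall I J, P I -> P J -> P (I :|: J)) ->
  (forall I, I \in R -> P I /\ FI I (u I - 1)) -> FS P (\prod_(I <- R) u I - 1).
Proof.
move=> PU Pu; rewrite big_seq; apply: (big_ind (fun a => FS P (a - 1))).
- by rewrite subrr; apply: FS0.
- by move=> a b; apply: near1M.
- by move=> I /Pu[PI Fu]; apply: FS_FI PI Fu.
Qed.

Lemma unitMnM (u v : A) : unitMn x y u -> unitMn x y v -> unitMn x y (u * v).
Proof.
move=> [uU /inMn_FS Fu /inMn_FS Fu'] [vU /inMn_FS Fv /inMn_FS Fv'].
split; first by rewrite unitrMl.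
  by apply/inMn_FS/near1M => //; apply: nonemptyU.
by rewrite invrM //; apply/inMn_FS/near1M => //; apply: nonemptyU.
Qed.

Lemma unitMnV (u : A) : unitMn x y u -> unitMn x y u^-1.
Proof. by move=> [uU Fu Fu']; split; rewrite ?unitrV ?invrK. Qed.

Lemma unitMn_prod (R : seq {set 'I_n}) (u : {set 'I_n} -> A) :
  (forall I, I \in R -> I != set0 /\ unitMI x y I (u I)) ->
  unitMn x y (\prod_(I <- R) u I).
Proof.
move=> Ru; rewrite big_seq; apply: big_ind.
- by split; rewrite ?unitr1 ?invr1 //; apply/inMn_FS; rewrite subrr; apply: FS0.
- exact: unitMnM.
- move=> I /Ru[I0 /unitMI_FI[uU Fu Fu']].
  by split=> //; apply/inMn_FS; apply: FS_FI; eassumption.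
Qed.

Lemma omega_prod_omega (R : seq {set 'I_n}) (u : {set 'I_n} -> A) :
  (forall I, I \in R -> u I \is a GRing.unit) ->
  \prod_(I <- R) u I \is a GRing.unit /\
  omega_prod R u =1 omega (\prod_(I <- R) u I).
Proof.
elim: R => [|I R IH] uU; first by rewrite big_nil unitr1; split=> // a; rewrite /omega invr1 mulr1 mul1r.
have [|PU PE] := IH; first by move=> J JR; apply: uU; rewrite inE JR orbT.
have uI := uU I (mem_head _ _); rewrite big_cons; split; first by rewrite unitrMl.
by move=> a; rewrite /= PE /omega invrM // !mulrA.
Qed.

(** c - 1 lies in the sum of all P_i and commutes with every x_i, hence is 0. This makes the passage
    from u to omega_u injective. *)
Lemma near1_central (c : A) : FS nonempty (c - 1) ->
  (forall i, GRing.comm c (x i)) -> c = 1.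
Proof.
move=> Fc cx; apply/eqP; rewrite -subr_eq0; apply/eqP.
apply: (JT_comm_eq0 hS (T := setT)).
  by apply: FS_JT Fc => I /set0Pn[i iI]; exists i; rewrite ?inE.
by move=> i _; apply/commr_sym/commrB; [apply/commr_sym|apply: commr1].
Qed.

Lemma omega_inj (u v : A) : unitMn x y u -> unitMn x y v -> omega u =1 omega v -> u = v.
Proof.
move=> hu hv uv; have [uU _ _] := hu; have [vU _ _] := hv.
have : v^-1 * u = 1.
  have [_ /inMn_FS Fc _] := unitMnM (unitMnV hv) hu.
  apply: near1_central => // i; have := uv (x i); rewrite /omega.
  move=> /(congr1 (fun z => v^-1 * z * u)).
  by rewrite /GRing.comm -!mulrA mulVr // mulr1 mulKr // => ->.
by move=> /(congr1 (fun z => v * z)); rewrite mulrA divrr // mul1r mulr1.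
Qed.

(** Modulo the sum of the P_t with t outside I0 all later factors become 1, so the product
    determines u(I0), an element free of those indices. Cancelling it leaves a shorter list. *)
Lemma prod_unique (R : seq {set 'I_n}) (u v : {set 'I_n} -> A) :
  uniq R -> sorted card_le R -> upset R ->
  (forall I, I \in R -> unitMI x y I (u I)) ->
  (forall I, I \in R -> unitMI x y I (v I)) ->
  \prod_(I <- R) u I = \prod_(I <- R) v I -> forall I, I \in R -> u I = v I.
Proof.
elim: R => [|I0 R IH] //= /andP[I0R uR] sR up Mu Mv.
have [RI0 upR] := upset_cons I0R sR up.
have hd := mem_head I0 R; have tl I : I \in R -> I \in I0 :: R by rewrite inE => ->; rewrite orbT.
have [u0U Fu _] := (unitMI_FI _ _).1 (Mu I0 hd).
have [v0U Fv _] := (unitMI_FI _ _).1 (Mv I0 hd).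
have RU I J : I \in R -> J \in R -> I :|: J \in R by move=> IR _; apply: upR IR (subsetUl _ _).
have near (w : {set 'I_n} -> A) : (forall I, I \in I0 :: R -> unitMI x y I (w I)) ->
    FS (mem R) (\prod_(I <- R) w I - 1) /\
    FS (mem R) (\prod_(I <- I0 :: R) w I - w I0).
  move=> Mw; have F1 : FS (mem R) (\prod_(I <- R) w I - 1).
    apply: prod_near1 => // I IR; split=> //.
    by have [] := (unitMI_FI _ _).1 (Mw I (tl I IR)).
  split=> //; rewrite big_cons -[X in _ - X]mulr1 -mulrBr.
  have [_ Fw _] := (unitMI_FI _ _).1 (Mw I0 hd).
  apply: (proj1 (FS_mul_near1 _ Fw F1)) => J JR.
  by apply: upR JR (subsetUr _ _).
have [_ Nu] := near u Mu; have [_ Nv] := near v Mv.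
move=> uv; have uv0 : u I0 = v I0.
  apply/eqP; rewrite -subr_eq0; apply/eqP; apply: (JT_gen_eq0 hS (T := ~: I0)).
    have -> : u I0 - v I0 = (\prod_(I <- I0 :: R) v I - v I0) - (\prod_(I <- I0 :: R) u I - u I0).
      by rewrite uv opprB [RHS]addrC [RHS]addrA subrK.
    apply: (FS_JT (R := mem R)); last by apply: FSB; [apply: Nv|apply: Nu].
    by move=> J /RI0/subsetPn[i iJ iI0]; exists i; rewrite ?inE.
  have -> : u I0 - v I0 = (u I0 - 1) - (v I0 - 1) by rewrite opprB addrA subrK.
  by apply: genB; [case: Fu|case: Fv].
move=> I; rewrite inE => /orP[/eqP->//|IR].
apply: (IH uR (path_sorted sR) upR) => //; [by move=> J /tl; apply: Mu|by move=> J /tl; apply: Mv|].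
by move: uv; rewrite !big_cons uv0 => /(mulrI v0U).
Qed.

(** * Inner automorphisms and their differences on generators *)

Lemma FS_commutator (a : A) i : FS nonempty a ->
  FS nonempty (a * x i - x i * a) /\ FS nonempty (a * y i - y i * a).
Proof.
elim=> [|I b c I0 Fb _ [IHx IHy]]; first by rewrite !mulr0 !mul0r subrr; split; apply: FS0.
have sub z : (b + c) * z - z * (b + c) = (b * z - z * b) + (c * z - z * c).
  by rewrite mulrDl mulrDr opprD addrACA.
rewrite !sub; have [gb Pb] := Fb.
(* F(I) is stable under x_i and y_i when i is in I, and commutes with them otherwise, so no new
   index sets appear. *)
have [iI|iI] := boolP (i \in I).
  have iC : i \notin ~: I by rewrite inE negbK.
  have gx := gen_x x y iC; have gy := gen_y x y iC.
  by split; apply: FSD => //; apply: (FS_FI I0); apply: FIB;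
    [exact: (FIMr hS)|exact: FIMl|exact: (FIMr hS)|exact: FIMl].
have iC : i \in ~: I by rewrite inE.
by rewrite (gen_commx hS iC gb) (gen_commy hS iC gb) !subrr !add0r.
Qed.

Lemma omega_diff (u z : A) : unitMn x y u -> FS nonempty ((u - 1) * z - z * (u - 1)) ->
  FS nonempty (omega u z - z).
Proof.
move=> [uU _ /inMn_FS Fu'] Fz; rewrite /omega.
have -> : u * z * u^-1 - z = ((u - 1) * z - z * (u - 1)) * u^-1.
  have -> : (u - 1) * z - z * (u - 1) = u * z - z * u.
    by rewrite mulrBl mulrBr mul1r mulr1 opprB addrA subrK.
  by rewrite mulrBl mulrK.
rewrite -[u^-1](subrK 1) mulrDr mulr1; apply: FSD => //.
by apply: (FSM hS) Fz Fu'; apply: nonemptyU.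
Qed.

Lemma omega_aut (u : A) : unitMn x y u -> is_alg_aut (omega u) /\
  forall i, FS nonempty (omega u (x i) - x i) /\ FS nonempty (omega u (y i) - y i).
Proof.
move=> hu; have [uU /inMn_FS Fu _] := hu; split.
  have id_aut : is_alg_aut (@id A) by split=> //; exists id.
  exact: conj_aut id_aut (mulVr uU) (divrr uU).
by move=> i; have [Fx Fy] := FS_commutator i Fu; split; apply: omega_diff.
Qed.

(** [FS_support] keeps only components whose set contains i, so the scalar one disappears. *)
Lemma aut_FS_nonempty s : is_alg_aut s ->
  (forall i, inFn x y (s (x i) - x i) /\ inFn x y (s (y i) - y i)) ->
  forall i, FS nonempty (s (x i) - x i) /\ FS nonempty (s (y i) - y i).
Proof.
move=> [[_ s1 sM] _] Fs i; have [/inFn_FS Fx /inFn_FS Fy] := Fs i.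
have [] : FS (fun I => predT I && (i \in I)) (s (x i) - x i) /\
          FS (fun I => predT I && (i \in I)) (s (y i) - y i).
  by apply: FS_support => //; rewrite ![_ + (_ - _)]addrC !subrK -sM (yx hS).
have ne I : predT I && (i \in I) -> I != set0 by move=> iI; apply/set0Pn; exists i.
by move=> /(FS_sub ne) ? /(FS_sub ne).
Qed.

Lemma ordered_factorization (R : seq {set 'I_n}) s :
  uniq R -> (forall I, (I \in R) = (I != set0)) -> sorted card_le R -> is_alg_aut s ->
  (forall i, FS nonempty (s (x i) - x i) /\ FS nonempty (s (y i) - y i)) ->
  exists u : {set 'I_n} -> A,
    (forall I, I != set0 -> unitMI x y I (u I)) /\ s =1 omega_prod R u.
Proof.
move=> uR mR sR s_aut Fs.
have neR I : I != set0 -> mem R I by move=> I0; rewrite -[X in is_true X]/(I \in R) mR.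
have upR : upset R.
  move=> J L; rewrite !mR => /set0Pn[i iJ] /subsetP JL.
  by apply/set0Pn; exists i; apply: JL.
have [||u [Mu sE]] := factorization uR sR _ upR s_aut.
- by rewrite mR eqxx.
- by move=> i; have [Fx Fy] := Fs i; split; apply: FS_sub neR _.
by exists u; split=> // I I0; apply: Mu; rewrite mR.
Qed.
End Final.

(** * Description of the group and unique factorisation *)

Theorem theorem7p8 (K : fieldType) (hK : [pchar K] =i pred0) (n : nat)
    (A : unitAlgType K) (x y : 'I_n -> A) (hS : is_Sn x y) :
  (* M_n = {omega_u | u in M_n^*} equals {sigma in G_n | sigma(x_i)-x_i, sigma(y_i)-y_i in F_n} *)
  (forall s : A -> A,
     (exists u, unitMn x y u /\ s =1 omega u) <->
     (is_alg_aut s /\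
      forall i, inFn x y (s (x i) - x i) /\ inFn x y (s (y i) - y i))) /\
  (* unique factorisation, for any ordering of the nonempty subsets by size *)
  (forall ord : seq {set 'I_n},
     uniq ord ->
     (forall I, (I \in ord) = (I != set0)) ->
     sorted (fun I J : {set 'I_n} => (#|I| <= #|J|)%N) ord ->
     forall s : A -> A, (exists u, unitMn x y u /\ s =1 omega u) ->
       (exists u : {set 'I_n} -> A,
          (forall I, I != set0 -> unitMI x y I (u I)) /\ s =1 omega_prod ord u) /\
       (forall u v : {set 'I_n} -> A,
          (forall I, I != set0 -> unitMI x y I (u I)) -> s =1 omega_prod ord u ->
          (forall I, I != set0 -> unitMI x y I (v I)) -> s =1 omega_prod ord v ->
          forall I, I != set0 -> u I = v I)).
Proof.
have prodE (ord : seq {set 'I_n}) (u : {set 'I_n} -> A) :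
    (forall I, (I \in ord) = (I != set0)) ->
    (forall I, I != set0 -> unitMI x y I (u I)) ->
    unitMn x y (\prod_(I <- ord) u I) /\ omega_prod ord u =1 omega (\prod_(I <- ord) u I).
  move=> ordE Mu; split.
    by apply: (unitMn_prod hS) => I; rewrite ordE => I0; split=> //; apply: Mu.
  by apply: (omega_prod_omega (R := ord) _).2 => I; rewrite ordE => /Mu[].
split=> [s|ord uR mR sR s [u0 [Mu0 s0]]].
  split=> [[u [hu sE]]|[s_aut /(aut_FS_nonempty hS s_aut) Fs]].
    have -> : s = omega u by apply/funext.
    have [u_aut Fu] := omega_aut hS hu; split=> // i.
    by have [? ?] := Fu i; split; apply: (FS_inFn hS).
  (* The first claim fixes no ordering, so the nonempty sets are sorted by cardinality. *)
  pose R := sort (@card_le n) (enum [pred I : {set 'I_n} | I != set0]).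
  have mR I : (I \in R) = (I != set0) by rewrite mem_sort mem_enum inE.
  have uR : uniq R by rewrite sort_uniq enum_uniq.
  have sR : sorted (@card_le n) R by apply: sort_sorted => I J; apply: leq_total.
  have [u [Mu sE]] := ordered_factorization hS uR mR sR s_aut Fs.
  have [MP PE] := prodE R u mR Mu.
  by exists (\prod_(I <- R) u I); split=> // a; rewrite sE PE.
split.
  have -> : s = omega u0 by apply/funext.
  have [u_aut Fu] := omega_aut hS Mu0.
  exact: (ordered_factorization hS).
move=> u v Mu su Mv sv I I0.
have [MU UE] := prodE ord u mR Mu; have [MV VE] := prodE ord v mR Mv.
(* Injectivity of the passage from u to omega_u turns equal automorphisms into equal products in
   A. *)
have UV : \prod_(J <- ord) u J = \prod_(J <- ord) v J.
  by apply: (omega_inj hS) => // a; rewrite -UE -VE -su sv.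
have upR : upset ord.
  move=> J L; rewrite !mR => /set0Pn[i iJ] /subsetP JL.
  by apply/set0Pn; exists i; apply: JL.
apply: (prod_unique hS uR sR upR _ _ UV); rewrite ?mR //.
  by move=> J; rewrite mR; apply: Mu.
by move=> J; rewrite mR; apply: Mv.
Qed.
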